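(* Let $\Lambda$ be an algebra of global dimension $2$ such that there are only finitely many isomorphism classes of basic tilting $\Lambda$-modules and only finitely many isomorphism classes of basic tilting $\Lambda^{op}$-modules. If every indecomposable $\tau$-rigid $\Lambda$-module of projective dimension $2$ is of grade $2$, then $\Lambda$ is $\tau$-tilting finite.
   Context: All algebras are basic connected finite-dimensional algebras over an algebraically closed field $K$, and all modules are finitely generated right modules. $\Lambda^{op}$ is the opposite algebra. $|M|$ is the number of pairwise non-isomorphic indecomposable direct summands of $M$; $M$ is basic if its indecomposable direct summands are pairwise non-isomorphic. A $\Lambda$-module $T$ is a (classical) tilting module if $\mathrm{pd}_\Lambda T\le 1$, $\mathrm{Ext}^1_\Lambda(T,T)=0$ and $|T|=|\Lambda|$. Let $\tau$ be the Auslander–Reiten translation; $M$ is $\tau$-rigid if $\mathrm{Hom}_\Lambda(M,\tau M)=0$. For an integer $i\ge1$, $\mathrm{grade}\,M\ge i$ means $\mathrm{Ext}^j_\Lambda(M,\Lambda)=0$ for $0\le j\le i-1$; $M$ is of grade $2$ if $\mathrm{grade}\,M\ge2$ and $\mathrm{Ext}^2_\Lambda(M,\Lambda)\ne0$. $\Lambda$ is $\tau$-tilting finite if there are only finitely many isomorphism classes of indecomposable $\tau$-rigid $\Lambda$-modules. *)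

(* Defs.v *)
From HB Require Import structures.
From mathcomp Require Import all_boot all_algebra all_field.
From mathcomp Require Import boolp classical_sets functions.

Set Implicit Arguments.
Unset Strict Implicit.
Unset Printing Implicit Defensive.

Import GRing.Theory.
Local Open Scope ring_scope.

(* Right modules over an algebra A are left modules over the converse ring,    *)
(* that is, objects of lmodType A^c with m . a := (a : A^c) *: m.  Right       *)
(* modules over the opposite algebra of A are left A-modules, that is, objects *)
(* of lmodType A.  The notions of the next section are stated for the left     *)
(* modules over a ring R and used with R := A^c and R := A.                    *)
(* Pitfall: A^c carries the opposite ring structure, but no opposite K-algebra *)
(* structure is declared on it (unification of A^c : algType K falls back to   *)
(* A), so A^c is only ever used as a ring.                                     *)

Section Modules.
Variable R : nzRingType.
Implicit Types M N P T X Y : lmodType R.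

Definition surj (U V : Type) (f : U -> V) : Prop := forall y, exists x, f x = y.

Definition zero_mod M : Prop := forall x : M, x = 0.

Definition iso_mod M N : Prop := exists f : {linear M -> N}, bijective f.

Definition fin_gen M : Prop :=
  exists (n : nat) (v : 'I_n -> M),
    forall x : M, exists c : 'I_n -> R, x = \sum_(i < n) c i *: v i.

Definition summand X M : Prop :=
  exists Y : lmodType R, iso_mod (X * Y)%type M.

Definition indecomposable M : Prop :=
  ~ zero_mod M /\
  forall X Y, iso_mod M (X * Y)%type -> zero_mod X \/ zero_mod Y.

(* M is the direct sum of the F i, with injections inj and projections prj. *)
Definition direct_sum (n : nat) M (F : 'I_n -> lmodType R) : Prop :=
  exists (inj : forall i, {linear F i -> M})
         (prj : forall i, {linear M -> F i}),
    [/\ forall i (x : F i), prj i (inj i x) = x,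
        forall i j (x : F i), i != j -> prj j (inj i x) = 0
      & forall m : M, m = \sum_(i < n) inj i (prj i m)].

Definition basic_mod M : Prop :=
  exists (n : nat) (F : 'I_n -> lmodType R),
    [/\ direct_sum M F,
        forall i, indecomposable (F i)
      & forall i j, iso_mod (F i) (F j) -> i = j].

(* |M| = n *)
Definition num_summands M (n : nat) : Prop :=
  exists F : 'I_n -> lmodType R,
    [/\ forall i, indecomposable (F i) /\ summand (F i) M,
        forall i j, iso_mod (F i) (F j) -> i = j
      & forall X, indecomposable X -> summand X M ->
          exists i, iso_mod X (F i)].

Definition finitely_many (C : lmodType R -> Prop) : Prop :=
  exists (n : nat) (F : 'I_n -> lmodType R),
    forall M, C M -> exists i, iso_mod M (F i).

Definition projective P : Prop :=
  forall X Y (g : {linear X -> Y}) (f : {linear P -> Y}),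
    surj g -> exists h : {linear P -> X}, forall x, g (h x) = f x.

Definition exact X Y N (f : {linear X -> Y}) (g : {linear Y -> N}) : Prop :=
  forall y : Y, g y = 0 <-> exists x, f x = y.

Definition proj_resolution M (P : nat -> lmodType R)
    (d : forall n, {linear P n.+1 -> P n}) (e : {linear P 0%N -> M}) : Prop :=
  [/\ forall n, fin_gen (P n) /\ projective (P n),
      surj e,
      exact (d 0%N) e
    & forall n, exact (d n.+1) (d n)].

Definition pdim_le M (n : nat) : Prop :=
  exists (P : nat -> lmodType R) (d : forall i, {linear P i.+1 -> P i})
         (e : {linear P 0%N -> M}),
    proj_resolution d e /\ forall i, (n < i)%N -> zero_mod (P i).

Definition pdim_eq M (n : nat) : Prop :=
  pdim_le M n /\ forall m, pdim_le M m -> (n <= m)%N.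

Definition gldim_le (n : nat) : Prop := forall M, fin_gen M -> pdim_le M n.

Definition gldim_eq (n : nat) : Prop :=
  gldim_le n /\ forall m, gldim_le m -> (n <= m)%N.

(* Cocycles and coboundaries of degree n of the complex Hom(P_*, N), whose     *)
(* cohomology is Ext^n(M, N) when (P, d) resolves M.                           *)
Definition cocycle (P : nat -> lmodType R) (d : forall n, {linear P n.+1 -> P n})
    N (n : nat) (f : {linear P n -> N}) : Prop :=
  forall x, f (d n x) = 0.

Definition coboundary (P : nat -> lmodType R)
    (d : forall n, {linear P n.+1 -> P n}) N (n : nat) :
    {linear P n -> N} -> Prop :=
  match n return {linear P n -> N} -> Prop with
  | 0%N => fun f => forall x, f x = 0
  | m.+1 => fun f => exists g : {linear P m -> N}, forall x, f x = g (d m x)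
  end.

(* Ext^n(M, N) = 0, for M with a resolution by finitely generated projectives; *)
(* the choice of the resolution is immaterial.                                 *)
Definition ext_eq0 (n : nat) M N : Prop :=
  exists (P : nat -> lmodType R) (d : forall i, {linear P i.+1 -> P i})
         (e : {linear P 0%N -> M}),
    proj_resolution d e /\
    forall f : {linear P n -> N}, cocycle d f -> coboundary d f.

Definition grade_ge M (i : nat) : Prop :=
  forall j, (j < i)%N -> ext_eq0 j M R^o.

Definition grade2 M : Prop := grade_ge M 2 /\ ~ ext_eq0 2 M R^o.

Definition tilting T : Prop :=
  [/\ fin_gen T,
      pdim_le T 1,
      ext_eq0 1 T T
    & exists n, num_summands T n /\ num_summands R^o n].

Definition fin_many_basic_tilting : Prop :=
  finitely_many (fun T => tilting T /\ basic_mod T).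

Definition superfluous M (L : {pred M}) : Prop :=
  forall S : {pred M}, submod_closed S ->
    (forall x, exists s l, [/\ s \in S, l \in L & x = s + l]) ->
    forall x, x \in S.

(* P1 -d-> P0 -e-> M -> 0 is exact, e is a projective cover of M and d induces *)
(* a projective cover of the kernel of e.                                      *)
Definition min_proj_presentation P1 P0 M
    (d : {linear P1 -> P0}) (e : {linear P0 -> M}) : Prop :=
  [/\ [/\ fin_gen P1, projective P1, fin_gen P0 & projective P0],
      surj e,
      exact d e,
      superfluous [pred x : P0 | e x == 0]
    & superfluous [pred x : P1 | d x == 0]].

End Modules.

(* The left A-module Hom_A(P, A) of a right A-module P. *)
Section Star.
Variables (A : nzRingType) (P : lmodType A^c).

Definition star_pred : {pred P -> A} :=
  fun f => `[< linear (f : P -> (A^c)^o) >].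

Record star := Star { star_fun :> P -> A; _ : star_fun \in star_pred }.

HB.instance Definition _ := [isSub for star_fun].
HB.instance Definition _ := [Choice of star by <:].

Fact star_zmod_closed : zmod_closed star_pred.
Proof.
split=> [|f g]; rewrite !unfold_in.
  by apply/asboolP => a x y /=; rewrite scaler0 addr0.
move=> /asboolP fl /asboolP gl; apply/asboolP => a x y.
have E u : (f - g) u = f u - g u by [].
by rewrite !E fl gl scalerBr opprD addrACA.
Qed.
HB.instance Definition _ :=
  GRing.isZmodClosed.Build (P -> A) star_pred star_zmod_closed.
HB.instance Definition _ := [SubChoice_isSubZmodule of star by <:].

Fact star_scale_subproof (a : A) (f : star) :
  (fun x => a * f x) \in star_pred.
Proof.
case: f => f /=; rewrite !unfold_in => /asboolP fl.
apply/asboolP => b x y; rewrite fl mulrDr; congr (_ + _).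
exact: (@mulrA A a (f x) b).
Qed.

Definition star_scale (a : A) (f : star) : star := Star (star_scale_subproof a f).

Fact star_scaleA a b f : star_scale a (star_scale b f) = star_scale (a * b) f.
Proof. by apply/val_inj/funext => x /=; rewrite mulrA. Qed.
Fact star_scale1 : left_id 1 star_scale.
Proof. by move=> f; apply/val_inj/funext => x /=; rewrite mul1r. Qed.
Fact star_scaleDr : right_distributive star_scale +%R.
Proof. by move=> a f g; apply/val_inj/funext => x; exact: mulrDr. Qed.
Fact star_scaleDl f : {morph star_scale^~ f : a b / a + b}.
Proof. by move=> a b; apply/val_inj/funext => x; exact: mulrDl. Qed.

HB.instance Definition _ := GRing.Zmodule_isLmodule.Build A star
  star_scaleA star_scale1 star_scaleDr star_scaleDl.

End Star.

(* The right A-module D T = Hom_K(T, K) of a left A-module T, on which K acts  *)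
(* through k |-> k%:A.                                                         *)
Section Dual.
Variables (K : fieldType) (A : algType K) (T : lmodType A).

Definition dual_pred : {pred T -> K} :=
  fun f => `[< forall (k : K) (x y : T), f (k%:A *: x + y) = k * f x + f y >].

Record dual := Dual { dual_fun :> T -> K; _ : dual_fun \in dual_pred }.

HB.instance Definition _ := [isSub for dual_fun].
HB.instance Definition _ := [Choice of dual by <:].

Fact dual_zmod_closed : zmod_closed dual_pred.
Proof.
split=> [|f g]; rewrite !unfold_in.
  by apply/asboolP => a x y /=; rewrite mulr0 addr0.
move=> /asboolP fl /asboolP gl; apply/asboolP => a x y.
have E u : (f - g) u = f u - g u by [].
by rewrite !E fl gl mulrBr opprD addrACA.
Qed.
HB.instance Definition _ :=
  GRing.isZmodClosed.Build (T -> K) dual_pred dual_zmod_closed.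
HB.instance Definition _ := [SubChoice_isSubZmodule of dual by <:].

Fact dual_scale_subproof (a : A) (f : dual) :
  (fun x => f (a *: x)) \in dual_pred.
Proof.
case: f => f /=; rewrite !unfold_in => /asboolP fl.
apply/asboolP => k x y; rewrite -fl; congr f.
by rewrite scalerDr !scalerA -scalerAr -scalerAl mulr1 mul1r.
Qed.

Definition dual_scale (a : A^c) (f : dual) : dual :=
  Dual (dual_scale_subproof a f).

Fact dual_scaleA a b f : dual_scale a (dual_scale b f) = dual_scale (a * b) f.
Proof. by apply/val_inj/funext => x /=; rewrite scalerA. Qed.
Fact dual_scale1 : left_id 1 dual_scale.
Proof. by move=> f; apply/val_inj/funext => x /=; rewrite scale1r. Qed.
Fact dual_scaleDr : right_distributive dual_scale +%R.
Proof. by move=> a f g; apply/val_inj/funext. Qed.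
Fact dual_scaleDl f : {morph dual_scale^~ f : a b / a + b}.
Proof.
move=> a b; apply/val_inj/funext => x.
have E u : val (dual_scale a f + dual_scale b f) u =
    f ((a : A) *: u) + f ((b : A) *: u).
  by [].
rewrite E /=; case: f {E} => f /=; rewrite unfold_in => /asboolP fl.
have := fl 1 ((a : A) *: x) ((b : A) *: x); rewrite scale1r scale1r mul1r => <-.
by congr f; exact: scalerDl.
Qed.

HB.instance Definition _ := GRing.Zmodule_isLmodule.Build A^c dual
  dual_scaleA dual_scale1 dual_scaleDr dual_scaleDl.

End Dual.

Section Algebras.
Variables (K : fieldType) (A : falgType K).

(* The left A-module N is the transpose Tr M of the right A-module M: the      *)
(* cokernel of Hom(d, A) : Hom(P0, A) -> Hom(P1, A) for a minimal projective   *)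
(* presentation P1 -d-> P0 -> M -> 0.                                          *)
Definition is_transpose (M : lmodType A^c) (N : lmodType A) : Prop :=
  exists (P1 P0 : lmodType A^c) (d : {linear P1 -> P0}) (e : {linear P0 -> M})
         (c : {linear star P1 -> N}),
    [/\ min_proj_presentation d e,
        surj c
      & forall u : star P1,
          c u = 0 <-> exists g : star P0, forall x, u x = g (d x)].

(* Hom(M, tau M) = 0 with tau M = D (Tr M); minimal projective presentations,  *)
(* hence Tr M, are unique up to isomorphism.                                   *)
Definition tau_rigid (M : lmodType A^c) : Prop :=
  exists N : lmodType A, is_transpose M N /\
    forall f : {linear M -> dual N}, forall x, f x = 0.

Definition tau_tilting_finite : Prop :=
  finitely_many (fun M : lmodType A^c =>
    [/\ fin_gen M, indecomposable M & tau_rigid M]).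

Definition basic_alg : Prop := basic_mod (A^c)^o.

Definition connected_alg : Prop :=
  forall (B C : algType K) (f : {lrmorphism A -> (B * C)%type}), ~ bijective f.

End Algebras.

(* Main.v *)
(* Let P1 -d-> P0 -> M -> 0 be a minimal projective presentation. Since         *)
(* Hom(M, D Tr M) = D(M (x) Tr M), M is tau-rigid exactly when every map        *)
(* P1 -> M factors through d, or equivalently every map P0^* -> Tr M factors    *)
(* through d^* : P0^* -> P1^*.  In the first form this gives Ext^1(M, M) = 0;   *)
(* so an indecomposable tau-rigid M of projective dimension at most one is, by  *)
(* Bongartz's completion, a summand of a basic tilting module.  If M has        *)
(* projective dimension two, grade two forces Hom(M, A) = 0, so that d^* is     *)
(* injective and 0 -> P0^* -> P1^* -> Tr M -> 0 is a projective resolution;     *)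
(* the second form gives Ext^1(Tr M, Tr M) = 0, hence the indecomposable Tr M   *)
(* is a summand of a basic tilting left module, and it determines M as          *)
(* Ext^1(Tr M, A).  Krull-Schmidt then leaves finitely many M.                  *)
(* That a Bongartz completion T has as many summands as A follows from two      *)
(* mutually inverse integer matrices: T_i |-> [Q0] - [Q1] for a projective      *)
(* resolution of T_i, and P_j |-> [U] - [V] for a coresolution                  *)
(* 0 -> P_j -> U -> V -> 0 in add T; both are well defined by Schanuel's lemma  *)
(* and its dual.                                                                *)

Require Import Defs.
From HB Require Import structures.
From mathcomp Require Import all_boot all_algebra all_field.
From mathcomp Require Import boolp classical_sets.

Set Implicit Arguments.
Unset Strict Implicit.
Unset Printing Implicit Defensive.

Import GRing.Theory.
Local Open Scope ring_scope.

(** * Submodules, quotients and linear relations *)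

Section LinearMaps.
Variable R : nzRingType.
Implicit Types (X Y Z M N : lmodType R).

(** Write A for the algebra, D for the K-dual and N = Tr M. An indecomposable tau-rigid module M
    either has projective dimension at most one and is itself a partial tilting module, or has
    projective dimension two and N is an indecomposable partial tilting module on the other side,
    from which M can be recovered. Finiteness of tilting modules on both sides then bounds both
    families.

    Tau-rigidity enters as a lifting property. Hom(M, D N) is the K-dual of the tensor product of M
    and N, which is the cokernel of Hom(P0, M) -> Hom(P1, M) and also of Hom(star P1, N) -> Hom(star
    P0, N). If it vanishes, both maps are onto: [hom_dual_extension] and [transpose_hom_extension].
    No tensor product is formed; a functional that vanishes on the image is turned directly into a
    homomorphism M -> D N.

    The first lifting property gives Ext^1(M, M) = 0 ([tau_rigid_ext1]). In projective dimension
    two, Hom(M, A) = 0 makes 0 -> star P0 -> star P1 -> N -> 0 a resolution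
    ([transpose_dual_resolution]), and the second gives Ext^1(N, N) = 0 ([transpose_ext1]). Lifting
    maps of N to such resolutions and dualizing shows that N is indecomposable
    ([transpose_indecomposable]) and determines M ([transposed_iso]).

    Both sides end in [partial_tilting_finite], which rests on Bongartz's completion ([bongartz],
    [partial_tilting_summand]). That the completion has exactly |A| summands is [tilting_count]: two
    integer matrices are mutually inverse. Their entries are multiplicities of indecomposable
    summands, well defined by Krull-Schmidt ([krull_unique]). *)

Lemma linearize X Y (f : X -> Y) :
  linear f -> exists g : {linear X -> Y}, forall x, g x = f x.
Proof.
move=> lf.
pose F := HB.pack f (GRing.isLinear.Build R X Y *:%R f lf) : {linear X -> Y}.
by exists F.
Qed.

(** Maps that involve a choice of preimage are built from their graphs: linearity of the graph is
    immediate, and single-valuedness has to be checked over 0 only. *)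
Definition linear_rel X Y (r : X -> Y -> Prop) : Prop :=
  forall a x y x' y', r x y -> r x' y' -> r (a *: x + x') (a *: y + y').

Lemma linear_rel_fun X Y (r : X -> Y -> Prop) : linear_rel r ->
  (forall y, r 0 y -> y = 0) -> forall x y y', r x y -> r x y' -> y = y'.
Proof.
move=> lr r0 x y y' rxy rxy'.
have := lr (-1) _ _ _ _ rxy' rxy; rewrite !scaleN1r addNr => /r0/eqP.
by rewrite addrC subr_eq0 => /eqP.
Qed.

Lemma linear_of_rel X Y (r : X -> Y -> Prop) : linear_rel r ->
  (forall x, exists y, r x y) -> (forall y, r 0 y -> y = 0) ->
  exists f : {linear X -> Y}, forall x, r x (f x).
Proof.
move=> lr /choice[f fP] r0.
have lf : linear f.
  by move=> a x y; apply: (linear_rel_fun lr r0 (fP _)); exact: lr.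
by have [g gE] := linearize lf; exists g => x; rewrite gE.
Qed.

Lemma iso_of_rel X Y (r : X -> Y -> Prop) : linear_rel r ->
  (forall x, exists y, r x y) -> (forall y, r 0 y -> y = 0) ->
  (forall y, exists x, r x y) -> (forall x, r x 0 -> x = 0) ->
  iso_mod X Y.
Proof.
move=> lr t1 f1 t2 f2; have [f fP] := linear_of_rel lr t1 f1.
have lr' : linear_rel (fun y x => r x y) by move=> a y x y' x'; exact: lr.
have [g gP] := linear_of_rel lr' t2 f2.
exists f, g => x; first exact: (linear_rel_fun lr' f2 (gP _)).
exact: (linear_rel_fun lr f1 (fP _)).
Qed.

Lemma iso_modP M N : iso_mod M N <->
  exists (f : {linear M -> N}) (g : {linear N -> M}), cancel f g /\ cancel g f.
Proof.
split=> [[f [g fK gK]]|[f [g [fK gK]]]]; last by exists f, g.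
have lg : linear g.
  by move=> a x y; apply: (can_inj fK); rewrite linearP !gK.
by have [h hE] := linearize lg; exists f, h; split=> x; rewrite hE.
Qed.

Lemma iso_bij M N (f : {linear M -> N}) :
  injective f -> surj f -> iso_mod M N.
Proof.
move=> fi fs; apply: (@iso_of_rel _ _ (fun x y => f x = y)).
- by move=> a x y x' y' <- <-; rewrite linearP.
- by move=> x; exists (f x).
- by move=> y <-; rewrite linear0.
- exact: fs.
- by move=> x; rewrite -{1}(linear0 f) => /fi.
Qed.

Lemma iso_refl M : iso_mod M M.
Proof. by exists idfun, id. Qed.

Lemma iso_sym M N : iso_mod M N -> iso_mod N M.
Proof. by move=> /iso_modP[f [g [fK gK]]]; apply/iso_modP; exists g, f. Qed.

Lemma iso_trans M N X : iso_mod M N -> iso_mod N X -> iso_mod M X.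
Proof.
move=> [f fb] [g gb]; exists (g \o f); exact: bij_comp.
Qed.

Lemma pair_linear X Y Z (f : {linear X -> Y}) (g : {linear X -> Z}) :
  exists h : {linear X -> (Y * Z)%type}, forall x, h x = (f x, g x).
Proof. by apply: linearize => a x y; rewrite !linearP. Qed.

Lemma sum_linear X Y Z (f : {linear X -> Z}) (g : {linear Y -> Z}) :
  exists h : {linear (X * Y)%type -> Z}, forall x, h x = f x.1 + g x.2.
Proof.
by apply: linearize => a x y; rewrite !linearP /= scalerDr addrACA.
Qed.

Lemma inl_linear X Y :
  exists h : {linear X -> (X * Y)%type}, forall x, h x = (x, 0).
Proof. by have [h hE] := pair_linear (@idfun X) (\0 : {linear X -> Y}); exists h. Qed.

Lemma inr_linear X Y :
  exists h : {linear Y -> (X * Y)%type}, forall x, h x = (0, x).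
Proof. by have [h hE] := pair_linear (\0 : {linear Y -> X}) (@idfun Y); exists h. Qed.

Lemma prod_linear X Y X' Y' (f : {linear X -> X'}) (g : {linear Y -> Y'}) :
  exists h : {linear (X * Y)%type -> (X' * Y')%type},
    forall x, h x = (f x.1, g x.2).
Proof.
have [h hE] := pair_linear (f \o (fst : {linear (X * Y)%type -> X}))
  (g \o (snd : {linear (X * Y)%type -> Y})).
by exists h.
Qed.

Lemma iso_prod X Y X' Y' :
  iso_mod X X' -> iso_mod Y Y' -> iso_mod (X * Y)%type (X' * Y')%type.
Proof.
move=> /iso_modP[f [f' [fK f'K]]] /iso_modP[g [g' [gK g'K]]].
have [h hE] := prod_linear f g; have [h' h'E] := prod_linear f' g'.
apply/iso_modP; exists h, h'; split=> -[x y].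
  by rewrite hE h'E /= fK gK.
by rewrite hE h'E /= f'K g'K.
Qed.

Lemma iso_prodC X Y : iso_mod (X * Y)%type (Y * X)%type.
Proof.
have [h hE] := pair_linear (snd : {linear (X * Y)%type -> Y})
  (fst : {linear (X * Y)%type -> X}).
by exists h, (fun x => (x.2, x.1)) => -[x y]; rewrite hE.
Qed.

Lemma iso_prodA X Y Z :
  iso_mod (X * (Y * Z))%type ((X * Y) * Z)%type.
Proof.
have [h hE] : exists h : {linear (X * (Y * Z))%type -> ((X * Y) * Z)%type},
    forall x, h x = ((x.1, x.2.1), x.2.2) by apply: linearize.
by exists h, (fun x => (x.1.1, (x.1.2, x.2))); [move=> [x [y z]]|move=> [[x y] z]]; rewrite hE.
Qed.

Lemma iso_prodCA X Y Z :
  iso_mod (X * (Y * Z))%type (Y * (X * Z))%type.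
Proof.
apply: iso_trans (iso_prodA _ _ _) (iso_trans _ (iso_sym (iso_prodA _ _ _))).
exact: iso_prod (iso_prodC _ _) (iso_refl _).
Qed.

Lemma iso_prodl0 X Z : zero_mod Z -> iso_mod (Z * X)%type X.
Proof.
move=> Z0; exists (snd : {linear (Z * X)%type -> X}), (fun x => (0, x)) => //.
by case=> z x /=; rewrite (Z0 z).
Qed.

Lemma iso_prodr0 X Z : zero_mod Z -> iso_mod (X * Z)%type X.
Proof.
by move=> Z0; apply: iso_trans (iso_prodC _ _) (iso_prodl0 _ Z0).
Qed.

Lemma iso_zero X Y : zero_mod X -> zero_mod Y -> iso_mod X Y.
Proof.
move=> X0 Y0; exists (\0 : {linear X -> Y}), (fun=> 0) => x.
  by rewrite (X0 x).
by rewrite (Y0 x).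
Qed.

Lemma zero_mod_iso X Y : iso_mod X Y -> zero_mod X -> zero_mod Y.
Proof. by move=> [f [g _ gK]] X0 y; rewrite -(gK y) (X0 (g y)) linear0. Qed.

Lemma zero_mod_prod X Y : zero_mod (X * Y)%type -> zero_mod X /\ zero_mod Y.
Proof. by move=> Z; split=> x; [case: (Z (x, 0))|case: (Z (0, x))]. Qed.

Lemma indec_iso X Y : iso_mod X Y -> indecomposable X -> indecomposable Y.
Proof.
move=> XY [X0 iX]; split=> [Y0|U V YUV].
  by apply: X0; exact: zero_mod_iso (iso_sym XY) Y0.
by apply: iX; exact: iso_trans XY YUV.
Qed.

Definition zmodule : lmodType R := {ffun 'I_0 -> R^o}.

Lemma zmodule0 : zero_mod zmodule.
Proof. by move=> x; apply/ffunP => -[]. Qed.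

Definition submod M (S : M -> Prop) : Prop :=
  S 0 /\ forall a x y, S x -> S y -> S (a *: x + y).

End LinearMaps.
Arguments zmodule R : clear implicits.
Arguments zmodule0 : clear implicits.

Section Sub.
Variables (R : nzRingType) (M : lmodType R) (S : M -> Prop).
Hypothesis SS : submod S.

(** The proof of [submod S] is a dummy argument, so that the type [sub_mod h] carries what its
    module structure needs. *)
Definition sub_pred (_ : submod S) : {pred M} := fun x => `[< S x >].

Record sub_mod (h : submod S) := SubMod { sub_val :> M; _ : sub_val \in sub_pred h }.

HB.instance Definition _ h := [isSub for @sub_val h].
HB.instance Definition _ h := [Choice of sub_mod h by <:].

Fact sub_submod_closed h : submod_closed (sub_pred h).
Proof.
split; first exact/asboolP/h.1.
by move=> a x y /asboolP Sx /asboolP Sy; apply/asboolP/h.2.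
Qed.
HB.instance Definition _ h :=
  GRing.isSubmodClosed.Build R M (sub_pred h) (sub_submod_closed h).
HB.instance Definition _ h := [SubChoice_isSubLmodule of sub_mod h by <:].

Lemma submod_ex : exists (L : lmodType R) (k : {linear L -> M}),
  injective k /\ forall x, S x <-> exists l, k l = x.
Proof.
exists (sub_mod SS), (val : {linear sub_mod SS -> M}).
split; first exact: val_inj.
move=> x; split=> [Sx|[l <-]]; last by case: l => u Su; exact/asboolP.
by exists (@SubMod SS x (asboolT Sx)).
Qed.

End Sub.

Section Quotient.
Variables (R : nzRingType) (M : lmodType R) (S : M -> Prop).

(** [choose] returns the same element for equivalent predicates, so each coset has one
    representative and the quotient can be the subtype of these representatives. *)
Definition quot_repr (h : submod S) (x : M) : M :=
  choose (fun y => `[< S (x - y) >]) x.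

Lemma quot_reprP h x : S (x - quot_repr h x).
Proof.
apply/asboolP; rewrite /quot_repr.
by apply: (@chooseP _ (fun y => `[< S (x - y) >])); apply/asboolP; rewrite subrr; exact: h.1.
Qed.

Lemma submodB (h : submod S) x y : S x -> S y -> S (x - y).
Proof. by move=> Sx Sy; rewrite addrC -scaleN1r; exact: h.2. Qed.

Lemma submodN (h : submod S) x : S x -> S (- x).
Proof. by move=> Sx; rewrite -sub0r; apply: submodB => //; exact: h.1. Qed.

Lemma submodD (h : submod S) x y : S x -> S y -> S (x + y).
Proof. by move=> Sx Sy; rewrite -[x]scale1r; exact: h.2. Qed.

Lemma submodZ (h : submod S) a x : S x -> S (a *: x).
Proof. by move=> Sx; rewrite -[_ *: _]addr0; apply: h.2 => //; exact: h.1. Qed.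

Lemma quot_repr_eq (h : submod S) x y : S (x - y) -> quot_repr h x = quot_repr h y.
Proof.
move=> Sxy; rewrite /quot_repr.
have E : (fun z => `[< S (x - z) >]) =1 (fun z => `[< S (y - z) >]).
  move=> z; apply/asboolP/asboolP => H.
    by rewrite -(subrKA x); apply: submodD => //; rewrite -opprB; exact: submodN.
  by rewrite -(subrKA y); apply: submodD.
rewrite (eq_choose E); apply: choose_id; apply/asboolP; rewrite ?subrr; last exact: h.1.
by rewrite -opprB; exact: submodN.
Qed.

Lemma quot_repr_id (h : submod S) x : quot_repr h (quot_repr h x) = quot_repr h x.
Proof. by apply: quot_repr_eq; rewrite -opprB; apply: submodN => //; exact: quot_reprP. Qed.

Record quot_mod (h : submod S) := QuotMod { quot_val : M;
  _ : quot_repr h quot_val == quot_val }.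
HB.instance Definition _ h := [isSub for @quot_val h].
HB.instance Definition _ h := [Choice of quot_mod h by <:].

Section Ops.
Variable h : submod S.
Notation Q := (quot_mod h).

Definition quot_pi (x : M) : Q := QuotMod (introT eqP (quot_repr_id h x)).

Lemma quot_piP x y : quot_pi x = quot_pi y <-> S (x - y).
Proof.
split=> [/(congr1 val)/= E|Sxy]; last by apply/val_inj/quot_repr_eq.
rewrite -(subrKA (quot_repr h x)); apply: submodD => //; first exact: quot_reprP.
by rewrite E -opprB; apply: submodN => //; exact: quot_reprP.
Qed.

Lemma quot_valK (q : Q) : quot_pi (val q) = q.
Proof. by apply/val_inj/eqP; case: q. Qed.

Definition quot_add (p q : Q) := quot_pi (val p + val q).
Definition quot_opp (p : Q) := quot_pi (- val p).
Definition quot_scale a (p : Q) := quot_pi (a *: val p).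

Lemma quot_val_pi x : S (x - val (quot_pi x)).
Proof. exact: quot_reprP. Qed.

Lemma quot_piD x y : quot_add (quot_pi x) (quot_pi y) = quot_pi (x + y).
Proof.
apply/quot_piP; rewrite -opprB; apply: submodN => //.
by rewrite opprD addrACA; apply: submodD => //; exact: quot_val_pi.
Qed.

Lemma quot_piN x : quot_opp (quot_pi x) = quot_pi (- x).
Proof.
by apply/quot_piP; rewrite opprK addrC; exact: quot_val_pi.
Qed.

Lemma quot_piZ a x : quot_scale a (quot_pi x) = quot_pi (a *: x).
Proof.
apply/quot_piP; rewrite -scalerBr; apply: submodZ => //.
by rewrite -opprB; apply: submodN => //; exact: quot_val_pi.
Qed.

Lemma quot_ind (P : Q -> Prop) : (forall x, P (quot_pi x)) -> forall q, P q.
Proof. by move=> H q; rewrite -(quot_valK q). Qed.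

Fact quot_addA : associative quot_add.
Proof.
by elim/quot_ind => x; elim/quot_ind => y; elim/quot_ind => t; rewrite !quot_piD addrA.
Qed.
Fact quot_addC : commutative quot_add.
Proof. by move=> p q; rewrite /quot_add addrC. Qed.
Fact quot_add0 : left_id (quot_pi 0) quot_add.
Proof. by elim/quot_ind => x; rewrite quot_piD add0r. Qed.
Fact quot_addN : left_inverse (quot_pi 0) quot_opp quot_add.
Proof. by elim/quot_ind => x; rewrite quot_piN quot_piD addNr. Qed.

HB.instance Definition _ :=
  GRing.isZmodule.Build Q quot_addA quot_addC quot_add0 quot_addN.

Fact quot_scaleA a b p : quot_scale a (quot_scale b p) = quot_scale (a * b) p.
Proof. by elim/quot_ind: p => x; rewrite !quot_piZ scalerA. Qed.
Fact quot_scale1 : left_id 1 quot_scale.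
Proof. by elim/quot_ind => x; rewrite quot_piZ scale1r. Qed.
Fact quot_scaleDr : right_distributive quot_scale +%R.
Proof.
move=> a; elim/quot_ind => x; elim/quot_ind => y.
by rewrite [_ + _]quot_piD !quot_piZ scalerDr -[LHS]quot_piD.
Qed.
Fact quot_scaleDl p : {morph quot_scale^~ p : a b / a + b}.
Proof.
move=> a b; elim/quot_ind: p => x.
by rewrite !quot_piZ scalerDl -[LHS]quot_piD.
Qed.
HB.instance Definition _ := GRing.Zmodule_isLmodule.Build R Q
  quot_scaleA quot_scale1 quot_scaleDr quot_scaleDl.

Lemma quot_ex : exists (C : lmodType R) (c : {linear M -> C}),
  surj c /\ forall x, c x = 0 <-> S x.
Proof.
have lpi : linear quot_pi.
  by move=> a x y; rewrite -[LHS]quot_piD -quot_piZ.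
have [c cE] := linearize lpi; exists Q, c; split=> [q|x].
  by exists (val q); rewrite cE quot_valK.
by rewrite cE -[0]/(quot_pi 0) quot_piP subr0.
Qed.

End Ops.
End Quotient.

(** * Short exact sequences and Ext^1 *)

Section Exact.
Variable R : nzRingType.
Implicit Types (A B C E L P Q X Y Z M N U V : lmodType R).

Lemma ker_ex X Y (f : {linear X -> Y}) : exists L (k : {linear L -> X}),
  injective k /\ forall x, f x = 0 <-> exists l, k l = x.
Proof.
apply: (@submod_ex R X (fun x => f x = 0)).
by split=> [|a x y fx fy]; rewrite ?linear0 // linearP fx fy scaler0 addr0.
Qed.

Definition ses A B C (i : {linear A -> B}) (p : {linear B -> C}) : Prop :=
  [/\ injective i, surj p & exact i p].

Lemma ses_comp0 A B C (i : {linear A -> B}) (p : {linear B -> C}) :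
  ses i p -> forall a, p (i a) = 0.
Proof. by move=> [_ _ E] a; apply/E; exists a. Qed.

Lemma ses_ker X Y (f : {linear X -> Y}) : surj f ->
  exists L (k : {linear L -> X}), ses k f.
Proof. by move=> fs; have [L [k [ki kE]]] := ker_ex f; exists L, k; split. Qed.

Lemma ses_coker X Y (f : {linear X -> Y}) : injective f ->
  exists C (c : {linear Y -> C}), ses f c.
Proof.
move=> fi; have S : submod (fun y => exists x, f x = y).
  split=> [|a _ _ [x <-] [y <-]]; first by exists 0; rewrite linear0.
  by exists (a *: x + y); rewrite linearP.
by have [C [c [cs cE]]] := quot_ex S; exists C, c; split.
Qed.

Lemma fin_gen_surj X Y (f : {linear X -> Y}) : surj f -> fin_gen X -> fin_gen Y.
Proof.
move=> fs [n [v vP]]; exists n, (f \o v) => y; have [x <-] := fs y.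
have [c ->] := vP x; exists c; rewrite linear_sum.
by apply: eq_bigr => i _; rewrite linearZ.
Qed.

Lemma fin_gen_iso X Y : iso_mod X Y -> fin_gen X -> fin_gen Y.
Proof. by move=> [f [g _ gK]]; apply: fin_gen_surj => y; exists (g y). Qed.

Lemma fin_gen_prod X Y : fin_gen X -> fin_gen Y -> fin_gen (X * Y)%type.
Proof.
move=> [n [v vP]] [m [w wP]].
have [a aE] := inl_linear X Y; have [b bE] := inr_linear X Y.
exists (n + m)%N, (fun k => match split k with inl i => a (v i) | inr j => b (w j) end).
move=> [x y]; have [c cE] := vP x; have [d dE] := wP y.
exists (fun k => match split k with inl i => c i | inr j => d j end).
rewrite big_split_ord /=.
have E1 : \sum_(i < n) match split (lshift m i) with inl i => c i | inr j => d j end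
    *: match split (lshift m i) with inl i => a (v i) | inr j => b (w j) end = a x.
  rewrite cE linear_sum; apply: eq_bigr => i _.
  by rewrite -[lshift m i]/(unsplit (inl i)) unsplitK linearZ.
have E2 : \sum_(i < m) match split (rshift n i) with inl i => c i | inr j => d j end
    *: match split (rshift n i) with inl i => a (v i) | inr j => b (w j) end = b y.
  rewrite dE linear_sum; apply: eq_bigr => i _.
  by rewrite -[rshift n i]/(unsplit (inr i)) unsplitK linearZ.
rewrite E1 E2 aE bE; apply/pair_eqP.
by rewrite /pair_eq /= addr0 add0r !eqxx.
Qed.

Definition fgproj P : Prop := fin_gen P /\ projective P.

Definition dual_basis P n (x : 'I_n -> P) (phi : 'I_n -> {linear P -> R^o}) :=
  forall y, y = \sum_(i < n) phi i y *: x i.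

Lemma linear_comb n P X (phi : 'I_n -> {linear P -> R^o}) (u : 'I_n -> X) :
  exists h : {linear P -> X}, forall y, h y = \sum_(i < n) phi i y *: u i.
Proof.
apply: linearize => a x y; rewrite scaler_sumr -big_split /=.
by apply: eq_bigr => i _; rewrite linearP scalerDl scalerA.
Qed.

Lemma dual_basis_fgproj P n (x : 'I_n -> P) phi : dual_basis x phi -> fgproj P.
Proof.
move=> E; split=> [|X Y g f gs]; first by exists n, x => y; exists (phi^~ y).
have [u uE] := choice (fun i => gs (f (x i))).
have [h hE] := linear_comb phi u; exists h => y.
rewrite hE linear_sum [in RHS](E y) linear_sum.
by apply: eq_bigr => i _; rewrite !linearZ /= uE.
Qed.

Lemma ffun_coord X n (i : 'I_n) :
  exists f : {linear {ffun 'I_n -> X} -> X}, forall x, f x = x i.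
Proof. by apply: linearize => a x y; rewrite !ffunE. Qed.

Lemma free_dual_basis n : exists (x : 'I_n -> {ffun 'I_n -> R^o})
  (phi : 'I_n -> {linear {ffun 'I_n -> R^o} -> R^o}),
  dual_basis x phi /\ forall i y, phi i y = y i.
Proof.
have [phi phiE] := choice (@ffun_coord R^o n).
exists (fun i => [ffun j => (i == j)%:R]), phi; split=> // y.
apply/ffunP => j; rewrite sum_ffunE (bigD1 j) //= !ffunE phiE eqxx.
rewrite [_ *: _]mulr1 big1 ?addr0 // => i /negbTE ij.
by rewrite !ffunE ij [_ *: _]mulr0.
Qed.

Lemma fgproj_free n : fgproj {ffun 'I_n -> R^o}.
Proof. by have [x [phi [/dual_basis_fgproj]]] := free_dual_basis n. Qed.

Lemma free_cover X n (v : 'I_n -> X) :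
  (forall x, exists c : 'I_n -> R, x = \sum_(i < n) c i *: v i) ->
  exists p : {linear {ffun 'I_n -> R^o} -> X},
    surj p /\ forall c, p c = \sum_(i < n) c i *: v i.
Proof.
move=> vP; have [x [phi [_ phiE]]] := free_dual_basis n.
have [p pE] := linear_comb phi v; exists p; split=> [y|c].
  have [c ->] := vP y; exists [ffun i => c i]; rewrite pE.
  by apply: eq_bigr => i _; rewrite phiE ffunE.
by rewrite pE; apply: eq_bigr => i _; rewrite phiE.
Qed.

Lemma fgproj_cover X : fin_gen X ->
  exists P (p : {linear P -> X}), fgproj P /\ surj p.
Proof.
move=> [n [v /free_cover[p [ps _]]]].
by exists {ffun 'I_n -> R^o}, p; split=> //; exact: fgproj_free.
Qed.

Lemma fgproj_dual_basis P : fgproj P ->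
  exists n (x : 'I_n -> P) phi, dual_basis x phi.
Proof.
move=> [[n [v /free_cover[p [ps pE]]]] pr].
have [h hK] := pr _ _ p (@idfun P) ps.
have /choice[phi phiE] : forall i : 'I_n,
    exists f : {linear P -> R^o}, forall y, f y = h y i.
  by move=> i; apply: linearize => a x y; rewrite linearP !ffunE.
exists n, v, phi => y; rewrite -{1}[y]hK pE.
by apply: eq_bigr => i _; rewrite phiE.
Qed.

Lemma projective_retract P Q (i : {linear Q -> P}) (p : {linear P -> Q}) :
  cancel i p -> projective P -> projective Q.
Proof.
move=> iK pr X Y g f gs; have [h hE] := pr _ _ g (f \o p) gs.
by exists (h \o i) => x /=; rewrite hE /= iK.
Qed.

Lemma projective_iso P Q : iso_mod P Q -> projective P -> projective Q.
Proof. by move=> /iso_modP[f [g [fK gK]]]; exact: projective_retract gK. Qed.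

Lemma projective_prod P Q :
  projective P -> projective Q -> projective (P * Q)%type.
Proof.
move=> pP pQ X Y g f gs.
have [a aE] := inl_linear P Q; have [b bE] := inr_linear P Q.
have [h hE] := pP _ _ g (f \o a) gs; have [k kE] := pQ _ _ g (f \o b) gs.
have [l lE] := sum_linear h k; exists l => -[x y].
rewrite lE linearD hE kE /= -linearD aE bE; congr (f _); apply/pair_eqP.
by rewrite /pair_eq /= addr0 add0r !eqxx.
Qed.

Lemma projective_prodl P Q : projective (P * Q)%type -> projective P.
Proof.
have [a aE] := inl_linear P Q.
by apply: (projective_retract (i := a) (p := fst)) => x; rewrite aE.
Qed.

Lemma fin_gen_prodl P Q : fin_gen (P * Q)%type -> fin_gen P.
Proof. by apply: (fin_gen_surj (f := fst)) => x; exists (x, 0). Qed.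

Lemma fgproj_iso P Q : iso_mod P Q -> fgproj P -> fgproj Q.
Proof. by move=> PQ [fP pP]; split; [exact: fin_gen_iso PQ _|exact: projective_iso PQ _]. Qed.

Lemma fgproj_prod P Q : fgproj P -> fgproj Q -> fgproj (P * Q)%type.
Proof. by move=> [fP pP] [fQ pQ]; split; [exact: fin_gen_prod|exact: projective_prod]. Qed.

Lemma fgproj_prodl P Q : fgproj (P * Q)%type -> fgproj P.
Proof. by move=> [f p]; split; [exact: fin_gen_prodl f|exact: projective_prodl p]. Qed.

Lemma fgproj_zero Z : zero_mod Z -> fgproj Z.
Proof.
move=> Z0; apply: (@dual_basis_fgproj _ 0 (fun=> 0) (fun=> \0)) => y.
by rewrite big_ord0; exact: Z0.
Qed.

(** The map d need not be onto: the pullback of f and d projects onto P, and a splitting of this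
    projection gives the lift. *)
Lemma projective_lift P X Y (d : {linear X -> Y}) (f : {linear P -> Y}) :
  projective P -> (forall x, exists y, d y = f x) ->
  exists h : {linear P -> X}, forall x, d (h x) = f x.
Proof.
move=> pr df.
have S : submod (fun z : (P * X)%type => f z.1 = d z.2).
  by split=> [|a u v uE vE]; rewrite ?linear0 // !linearP uE vE.
have [Z [k [ki kE]]] := submod_ex S.
have [h hE] := pr _ _ (fst \o k : {linear Z -> P}) (@idfun P)
  (fun x => let: ex_intro y e := df x in
     let: ex_intro l el := (kE (x, y)).1 (esym e) in ex_intro _ l (congr1 fst el)).
exists (snd \o k \o h) => x /=.
have /(kE (k (h x))).2 <- : exists l, k l = k (h x) by exists (h x).
by rewrite [(k (h x)).1]hE.
Qed.

(* Both sides are the pullback of [B] and [B'] over [C]. *)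
Lemma schanuel A B C A' B' (i : {linear A -> B}) (p : {linear B -> C})
    (i' : {linear A' -> B'}) (p' : {linear B' -> C})
    (h : {linear B -> B'}) (k : {linear B' -> B}) :
  ses i p -> ses i' p' ->
  (forall b, p' (h b) = p b) -> (forall b, p (k b) = p' b) ->
  iso_mod (A * B')%type (A' * B)%type.
Proof.
move=> s s' hE kE; have pi0 := ses_comp0 s; have pi0' := ses_comp0 s'.
case: s s' => [ii ps ip] [ii' ps' ip'].
apply: (@iso_of_rel R _ _ (fun u v => v.2 = i u.1 + k u.2 /\ u.2 = i' v.1 + h v.2)).
- move=> a x y x' y' [e1 e2] [e3 e4] /=; split.
    by rewrite e1 e3 !linearP scalerDr addrACA.
  by rewrite {1}e2 {1}e4 !linearP scalerDr addrACA.
- move=> [a b'] /=.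
  have /ip'[a' e] : p' (b' - h (i a + k b')) = 0.
    by rewrite linearB /= hE linearD /= pi0 kE add0r subrr.
  by exists (a', i a + k b'); rewrite /= e subrK.
- move=> [a' b] /= [-> e]; move: e; rewrite !(linear0, addr0) => e.
  by rewrite (ii' a' 0) // -e linear0.
- move=> [a' b] /=.
  have /ip[a e] : p (b - k (i' a' + h b)) = 0.
    by rewrite linearB /= kE linearD /= pi0' hE add0r subrr.
  by exists (a, i' a' + h b); rewrite /= e subrK.
- move=> [a b'] /= [e e']; move: e; rewrite e' !(linear0, addr0) => e.
  by rewrite (ii a 0) // -e linear0.
Qed.

(* Both sides are the pushout of [U] and [U'] under [P]. *)
Lemma coschanuel P U V U' V' (i : {linear P -> U}) (p : {linear U -> V})
    (i' : {linear P -> U'}) (p' : {linear U' -> V'})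
    (h : {linear U -> U'}) (k : {linear U' -> U}) :
  ses i p -> ses i' p' ->
  (forall x, h (i x) = i' x) -> (forall x, k (i' x) = i x) ->
  iso_mod (U * V')%type (U' * V)%type.
Proof.
move=> s s' hE kE; have pi0 := ses_comp0 s; have pi0' := ses_comp0 s'.
case: s s' => [ii ps ip] [ii' ps' ip'].
apply: (@iso_of_rel R _ _ (fun u v => exists a a',
   [/\ u.1 = a + k a', u.2 = p' a', v.1 = a' + h a & v.2 = p a])).
- move=> c x y x' y' [a [a' [e1 e2 e3 e4]]] [b [b' [e5 e6 e7 e8]]].
  exists (c *: a + b), (c *: a' + b') => /=.
  by rewrite e1 e2 e3 e4 e5 e6 e7 e8 !linearP !scalerDr; split=> //; rewrite addrACA.
- move=> [u v'] /=; have [a' e] := ps' v'.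
  by exists (a' + h (u - k a'), p (u - k a')), (u - k a'), a'; rewrite subrK.
- move=> [u' v] [a [a' /= [/esym/eqP + /esym/ip'[x e2] -> ->]]].
  rewrite addr_eq0 => /eqP e1; rewrite e1 -e2 kE !linearN /= pi0 hE oppr0.
  by rewrite subrr.
- move=> [u' v] /=; have [a e] := ps v.
  by exists (a + k (u' - h a), p' (u' - h a)), a, (u' - h a); rewrite subrK.
- move=> [u v'] [a [a' /= [-> -> /esym/eqP + /esym/ip[x e2]]]].
  rewrite addr_eq0 => /eqP e1; rewrite e1 -e2 hE !linearN /= pi0' kE oppr0.
  by rewrite subrr.
Qed.

(* The vanishing of Ext^1(X, Y), tested on all extensions rather than on a     *)
(* projective resolution.                                                      *)
Definition ext1 X Y : Prop := forall A B (i : {linear A -> B}) (p : {linear B -> X}),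
  ses i p -> forall f : {linear A -> Y}, exists g : {linear B -> Y},
    forall a, g (i a) = f a.

(** For a lift l : P0 -> B of e, the middle term is B = i(A) + l(P0). The map l o d lands in A, and
    f after it is phi : P1 -> Y. If phi = psi o d, then f on i(A) and psi on l(P0) agree on the
    overlap and glue to a map on B. *)
Lemma ext1_presentation P1 P0 X Y (d : {linear P1 -> P0}) (e : {linear P0 -> X}) :
  projective P0 -> exact d e -> surj e ->
  (forall f : {linear P1 -> Y}, (forall x, d x = 0 -> f x = 0) ->
     exists g : {linear P0 -> Y}, forall x, f x = g (d x)) ->
  ext1 X Y.
Proof.
move=> pr de es H A B i p [ii ps ip] f.
have [l lE] := pr _ _ p e ps.
have [phi phiE] : exists phi : {linear P1 -> Y}, forall x,
    exists a, i a = l (d x) /\ phi x = f a.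
  apply: (@linear_of_rel R _ _ (fun x y => exists a, i a = l (d x) /\ y = f a)).
  - move=> c x y x' y' [a [e1 ->]] [a' [e2 ->]]; exists (c *: a + a').
    by rewrite !linearP e1 e2.
  - move=> x; have /ip[a aE] : p (l (d x)) = 0 by rewrite lE; apply/de; exists x.
    by exists (f a), a.
  - move=> y [a [+ ->]]; rewrite !linear0 -(linear0 i) => /ii ->.
    by rewrite linear0.
have [x dx0|psi psiE] := H phi.
  have [a [+ ->]] := phiE x; rewrite dx0 linear0 -(linear0 i) => /ii ->.
  by rewrite linear0.
have K a x : i a = l x -> f a = psi x.
  move=> E; have /de[q qE] : e x = 0 by rewrite -lE -E; apply/ip; exists a.
  have [a' [a'E fE]] := phiE q; rewrite -qE -psiE fE; congr (f _).
  by apply: ii; rewrite a'E E qE.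
have [g gE] : exists g : {linear B -> Y}, forall b,
    exists a x, b = i a + l x /\ g b = f a + psi x.
  apply: (@linear_of_rel R _ _ (fun b y => exists a x, b = i a + l x /\ y = f a + psi x)).
  - move=> c b y b' y' [a [x [-> ->]]] [a' [x' [-> ->]]].
    exists (c *: a + a'), (c *: x + x').
    by rewrite !linearP !scalerDr; split; rewrite addrACA.
  - move=> b; have [x xE] := es (p b).
    have /ip[a aE] : p (b - l x) = 0 by rewrite linearB /= lE xE subrr.
    by exists (f a + psi x), a, x; rewrite aE subrK.
  - move=> y [a [x [/esym/eqP + ->]]]; rewrite addr_eq0 -linearN => /eqP/K ->.
    by rewrite linearN addNr.
exists g => a; have [a' [x [aE ->]]] := gE (i a).
have /K : i (a - a') = l x by rewrite linearB /= aE addrC addKr.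
by rewrite linearB /= => <-; rewrite addrC subrK.
Qed.

Lemma ext1_projective P Y : projective P -> ext1 P Y.
Proof.
move=> pr; have : exact (\0 : {linear zmodule R -> P}) (@idfun P).
  move=> y; split=> [/= ->|[x <-] //]; by exists 0.
move/(ext1_presentation pr); apply; first by move=> y; exists y.
move=> f _; exists \0 => x.
by rewrite (zmodule0 R x) linear0.
Qed.

Lemma ext1_retractr X Y Y' (j : {linear Y' -> Y}) (q : {linear Y -> Y'}) :
  cancel j q -> ext1 X Y -> ext1 X Y'.
Proof.
move=> jK H A B i p s f; have [g gE] := H _ _ _ _ s (j \o f).
by exists (q \o g) => a /=; rewrite gE /= jK.
Qed.

(** The extension of X' is pulled back along q to an extension Z of X; the map found on Z is
    restricted to B along b |-> (b, j (p b)). *)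
Lemma ext1_retractl X X' Y (j : {linear X' -> X}) (q : {linear X -> X'}) :
  cancel j q -> ext1 X Y -> ext1 X' Y.
Proof.
move=> jK H A B i p s f.
have S : submod (fun z : (B * X)%type => p z.1 = q z.2).
  by split=> [|a u v uE vE]; rewrite ?linear0 // !linearP uE vE.
have [Z [k [ki kE]]] := submod_ex S.
have [i' i'E] : exists i' : {linear A -> Z}, forall a, k (i' a) = (i a, 0).
  apply: (@linear_of_rel R _ _ (fun a z => k z = (i a, 0))).
  - move=> c a z a' z' e e'; rewrite linearP e e' linearP; apply/pair_eqP.
    by rewrite /pair_eq /= scaler0 addr0 !eqxx.
  - move=> a; apply/(kE (i a, 0)); rewrite /= linear0.
    exact: ses_comp0 s a.
  - by move=> y; rewrite linear0 -[(0, 0)](linear0 k) => /ki.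
have s' : ses i' (snd \o k : {linear Z -> X}).
  case: s => ii ps ip; split.
  - by move=> a a' /(congr1 k); rewrite !i'E => -[/ii].
  - move=> x; have [b bE] := ps (q x).
    by have [z zE] := (kE (b, x)).1 bE; exists z; rewrite /= zE.
  - move=> z; split=> [/= z0|[a <-]]; last by rewrite /= i'E.
    have /ip[a aE] : p (k z).1 = 0.
      by have := (kE (k z)).2 (ex_intro _ z erefl); rewrite z0 linear0.
    by exists a; apply: ki; rewrite i'E aE -z0; case: (k z).
have [g gE] := H _ _ _ _ s' f.
have [t tE] : exists t : {linear B -> Z}, forall b, k (t b) = (b, j (p b)).
  apply: (@linear_of_rel R _ _ (fun b z => k z = (b, j (p b)))).
  - by move=> c a z a' z' e e'; rewrite linearP e e' !linearP.
  - by move=> b; apply/(kE (b, j (p b))); rewrite /= jK.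
  - by move=> y; rewrite !linear0 -[(0, 0)](linear0 k) => /ki.
exists (g \o t) => a /=; rewrite -gE; congr (g _); apply: ki.
by rewrite tE i'E (ses_comp0 s) linear0.
Qed.

Lemma ext1_isol X X' Y : iso_mod X X' -> ext1 X Y -> ext1 X' Y.
Proof. by move=> /iso_modP[f [g [fK gK]]]; exact: ext1_retractl gK. Qed.

Lemma ext1_isor X Y Y' : iso_mod Y Y' -> ext1 X Y -> ext1 X Y'.
Proof. by move=> /iso_modP[f [g [fK gK]]]; exact: ext1_retractr gK. Qed.

Lemma ext1_prodr X Y Y' : ext1 X Y -> ext1 X Y' -> ext1 X (Y * Y')%type.
Proof.
move=> H H' A B i p s f.
have [g gE] := H _ _ _ _ s (fst \o f); have [g' g'E] := H' _ _ _ _ s (snd \o f).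
have [h hE] := pair_linear g g'; exists h => a.
by rewrite hE gE g'E /=; case: (f a).
Qed.

(** The extension is done in two stages: first from A to Z, the preimage of X' in B, where Z/A is
    X', then from Z to B, where B/Z is X. *)
Lemma ext1_ses X' E X Y (a : {linear X' -> E}) (b : {linear E -> X}) :
  ses a b -> ext1 X' Y -> ext1 X Y -> ext1 E Y.
Proof.
move=> sab H' H A B i p s f.
have [ai bs ab] := sab; have [ii ps ip] := s.
have [Z [k [ki kE]]] := ker_ex (b \o p).
have sk : ses k (b \o p : {linear B -> X}).
  split=> // x; have [e <-] := bs x; have [y <-] := ps e.
  by exists y.
have [i' i'E] : exists i' : {linear A -> Z}, forall x, k (i' x) = i x.
  apply: (@linear_of_rel R _ _ (fun x z => k z = i x)).
  - by move=> c x z x' z' e e'; rewrite !linearP e e'.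
  - by move=> x; apply/(kE (i x)); rewrite /= (ses_comp0 s) linear0.
  - by move=> y; rewrite !linear0 -{1}(linear0 k) => /ki.
have [q qE] : exists q : {linear Z -> X'}, forall z, a (q z) = p (k z).
  apply: (@linear_of_rel R _ _ (fun z x => a x = p (k z))).
  - by move=> c x z x' z' e e'; rewrite !linearP e e'.
  - by move=> z; apply/(ab (p (k z)))/(kE (k z)); exists z.
  - by move=> y; rewrite !linear0 -{1}(linear0 a) => /ai.
have s' : ses i' q.
  split.
  - by move=> x y /(congr1 k); rewrite !i'E => /ii.
  - move=> x; have [y yE] := ps (a x).
    have /(kE y)[z zE] : (b \o p) y = 0 by rewrite /= yE (ses_comp0 sab).
    by exists z; apply: ai; rewrite qE zE.
  - move=> z; split=> [z0|[x <-]]; last first.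
      by apply: ai; rewrite qE i'E (ses_comp0 s) linear0.
    have /ip[x xE] : p (k z) = 0 by rewrite -qE z0 linear0.
    by exists x; apply: ki; rewrite i'E.
have [g gE] := H' _ _ _ _ s' f; have [h hE] := H _ _ _ _ sk g.
by exists h => x; rewrite -i'E hE gE.
Qed.

Lemma ses_prod A B C A' B' C' (i : {linear A -> B}) (p : {linear B -> C})
    (i' : {linear A' -> B'}) (p' : {linear B' -> C'}) :
  ses i p -> ses i' p' ->
  exists (j : {linear (A * A')%type -> (B * B')%type})
         (q : {linear (B * B')%type -> (C * C')%type}), ses j q.
Proof.
move=> [ii ps ip] [ii' ps' ip'].
have [j jE] := prod_linear i i'; have [q qE] := prod_linear p p'.
exists j, q; split.
- by move=> [a a'] [b b']; rewrite !jE => -[/ii /= -> /ii' /= ->].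
- move=> [c c']; have [b <-] := ps c; have [b' <-] := ps' c'.
  by exists (b, b'); rewrite qE.
- move=> [b b']; rewrite qE /=; split=> [[/ip[a <-] /ip'[a' <-]]|[[a a']]].
    by exists (a, a'); rewrite jE.
  rewrite jE => -[<- <-] /=.
  have -> : p (i a) = 0 by apply/ip; exists a.
  by have -> : p' (i' a') = 0 by apply/ip'; exists a'.
Qed.

Lemma ses_inl X Y (a : {linear X -> (X * Y)%type}) :
  (forall x, a x = (x, 0)) -> ses a (snd : {linear (X * Y)%type -> Y}).
Proof.
move=> aE; split.
- by move=> x y; rewrite !aE => -[].
- by move=> y; exists (0, y).
- by move=> [x y]; split=> [/= ->|[z]]; [exists x; rewrite aE|rewrite aE => -[_ <-]].
Qed.

Lemma ext1_prodl X X' Y : ext1 X Y -> ext1 X' Y -> ext1 (X * X')%type Y.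
Proof. by have [a aE] := inl_linear X X'; exact: ext1_ses (ses_inl aE). Qed.

Lemma ses_isor A B C C' (i : {linear A -> B}) (p : {linear B -> C}) :
  iso_mod C C' -> ses i p -> exists p' : {linear B -> C'}, ses i p'.
Proof.
move=> /iso_modP[f [g [fK gK]]] [ii ps ip]; exists (f \o p); split=> //.
  by move=> y; have [x xE] := ps (g y); exists x; rewrite /= xE gK.
move=> y; rewrite -ip /=; split=> [/(congr1 g)|->]; last by rewrite linear0.
by rewrite fK linear0.
Qed.

Lemma ses_isol A A' B C (i : {linear A -> B}) (p : {linear B -> C}) :
  iso_mod A A' -> ses i p -> exists i' : {linear A' -> B}, ses i' p.
Proof.
move=> /iso_modP[f [g [fK gK]]] [ii ps ip]; exists (i \o g); split=> //.
  by apply: inj_comp => //; exact: can_inj gK.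
move=> y; rewrite ip; split=> [[x <-]|[x <-]]; last by exists (g x).
by exists (f x); rewrite /= fK.
Qed.

Definition pd1 X : Prop := exists L P (i : {linear L -> P}) (p : {linear P -> X}),
  [/\ ses i p, fgproj L & fgproj P].

Lemma pd1_iso X Y : iso_mod X Y -> pd1 X -> pd1 Y.
Proof.
move=> XY [L [P [i [p [s fL fP]]]]]; have [p' s'] := ses_isor XY s.
by exists L, P, i, p'.
Qed.

Lemma pd1_prod X Y : pd1 X -> pd1 Y -> pd1 (X * Y)%type.
Proof.
move=> [L [P [i [p [s fL fP]]]]] [L' [P' [i' [p' [s' fL' fP']]]]].
have [j [q sq]] := ses_prod s s'; exists (L * L')%type, (P * P')%type, j, q.
by split=> //; exact: fgproj_prod.
Qed.

Lemma pd1_fin_gen X : pd1 X -> fin_gen X.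
Proof.
by move=> [L [P [i [p [[_ ps _] _ [fP _]]]]]]; exact: fin_gen_surj ps fP.
Qed.

(** Schanuel's lemma compares the product of covers of X and Y with the given resolution, so the
    kernel L of the cover of X is a summand of a finitely generated projective. *)
Lemma pd1_prodl X Y : pd1 (X * Y)%type -> pd1 X.
Proof.
move=> d; have fXY := pd1_fin_gen d.
have fX := fin_gen_prodl fXY.
have fY := fin_gen_prodl (fin_gen_iso (iso_prodC _ _) fXY).
have [P [p [fP ps]]] := fgproj_cover fX; have [P' [p' [fP' ps']]] := fgproj_cover fY.
have [L [i s]] := ses_ker ps; have [L' [i' s']] := ses_ker ps'.
have [j [q sq]] := ses_prod s s'.
have [N [Q [k [r [t fN fQ]]]]] := d.
have fPP := fgproj_prod fP fP'.
have [h hE] := fPP.2 _ _ r q (let: And3 _ a _ := t in a).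
have [g gE] := fQ.2 _ _ q r (let: And3 _ a _ := sq in a).
have I := schanuel sq t hE gE.
exists L, P, i, p; split=> //.
apply/fgproj_prodl/fgproj_prodl; apply: fgproj_iso (iso_sym I) _.
exact: fgproj_prod.
Qed.

End Exact.

(** * Finite length and the Krull-Schmidt theorem *)

Lemma bounded_max (T : Type) (P : T -> Prop) (u : T -> nat) (n : nat) :
  (exists t, P t) -> (forall t, P t -> (u t <= n)%N) ->
  exists t, P t /\ forall t', P t' -> (u t' <= u t)%N.
Proof.
move=> [t0 Pt0] H.
have exP : exists k, `[< exists2 t, P t & u t = k >] by exists (u t0); apply/asboolP; exists t0.
have ubP k : `[< exists2 t, P t & u t = k >] -> (k <= n)%N.
  by move=> /asboolP[t Pt <-]; exact: H.
case: (ex_maxnP exP ubP) => k /asboolP[t Pt <-] kmax; exists t; split=> // t' Pt'.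
by apply: kmax; apply/asboolP; exists t'.
Qed.

Section Length.
Variable R : nzRingType.
Implicit Types (A B X Y Z M N : lmodType R).

Definition length_fun M n (l : (M -> Prop) -> nat) : Prop :=
  (forall S, submod S -> (l S <= n)%N) /\
  forall S S', submod S -> submod S' -> (forall x, S x -> S' x) ->
    (l S' <= l S)%N -> forall x, S' x -> S x.

(* The length of M is at most n: a function with values in [0, n] is strictly *)
(* increasing on the submodules of M.                                         *)
Definition len_le M n : Prop := exists l : (M -> Prop) -> nat, length_fun n l.

Definition fin_len M : Prop := exists n, len_le M n.

Lemma length_mono M n l (S S' : M -> Prop) : length_fun n l ->
  submod S -> submod S' -> (forall x, S x -> S' x) -> (l S <= l S')%N.
Proof.
move=> [_ H] sS sS' SS'; case: leqP => // lt; have SS := H _ _ sS sS' SS' (ltnW lt).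
have E : S = S' by apply/funext => x; apply/propext; split; [exact: SS'|exact: SS].
by rewrite E ltnn in lt.
Qed.

Lemma submod_image X Y (f : {linear X -> Y}) S :
  submod S -> submod (fun y => exists2 x, S x & f x = y).
Proof.
move=> [S0 SP]; split=> [|a _ _ [x Sx <-] [y Sy <-]]; first by exists 0; rewrite ?linear0.
by exists (a *: x + y); [exact: SP|rewrite linearP].
Qed.

Lemma submod_preimage X Y (f : {linear X -> Y}) S :
  submod S -> submod (fun x => S (f x)).
Proof. by move=> [S0 SP]; split=> [|a x y Sx Sy]; rewrite ?linear0 ?linearP //; exact: SP. Qed.

Lemma submodT M : submod (fun _ : M => True).
Proof. by []. Qed.

Lemma len_le_inj X Y (f : {linear X -> Y}) n :
  injective f -> len_le Y n -> len_le X n.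
Proof.
move=> fi [l [ln lS]]; exists (fun S => l (fun y => exists2 x, S x & f x = y)).
split=> [S /(submod_image f)/ln //|S S' sS sS' SS' le x S'x].
have SSi y : (exists2 x, S x & f x = y) -> exists2 x, S' x & f x = y.
  by move=> [z Sz <-]; exists z => //; exact: SS'.
have S'fx : exists2 z, S' z & f z = f x by exists x.
have [y Sy /fi <- //] := lS _ _ (submod_image f sS) (submod_image f sS') SSi le _ S'fx.
Qed.

Lemma len_le_inj_proper X Y (f : {linear X -> Y}) n :
  injective f -> ~ surj f -> len_le Y n -> exists2 m, (m < n)%N & len_le X m.
Proof.
move=> fi fs [l lP]; have [ln lS] := lP.
have sI := submod_image f (@submodT X).
have lt : (l (fun y => exists2 x, True & f x = y) < n)%N.
  apply: leq_trans (ln _ (@submodT Y)); case: leqP => // le; exfalso; apply: fs => y.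
  by have [] := lS _ _ sI (@submodT Y) (fun _ _ => I) le y I => x _ <-; exists x.
exists (l (fun y => exists2 x, True & f x = y)) => //.
exists (fun S => l (fun y => exists2 x, S x & f x = y)).
split=> [S sS|S S' sS sS' SS' le x S'x].
  apply: (length_mono lP) => //; first exact: submod_image.
  by move=> _ [x _ <-]; exists x.
have SSi y : (exists2 x, S x & f x = y) -> exists2 x, S' x & f x = y.
  by move=> [z Sz <-]; exists z => //; exact: SS'.
have S'fx : exists2 z, S' z & f z = f x by exists x.
have [y Sy /fi <- //] := lS _ _ (submod_image f sS) (submod_image f sS') SSi le _ S'fx.
Qed.

Lemma len_le_surj X Y (f : {linear X -> Y}) n :
  surj f -> len_le X n -> len_le Y n.
Proof.
move=> fs [l [ln lS]]; exists (fun S => l (fun x => S (f x))).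
split=> [S /(submod_preimage f)/ln //|S S' sS sS' SS' le y].
have [x <-] := fs y.
by apply: (lS _ _ (submod_preimage f sS) (submod_preimage f sS') _ le) => z; exact: SS'.
Qed.

Lemma fin_len_inj X Y (f : {linear X -> Y}) : injective f -> fin_len Y -> fin_len X.
Proof. by move=> fi [n ln]; exists n; exact: len_le_inj fi ln. Qed.

Lemma fin_len_surj X Y (f : {linear X -> Y}) : surj f -> fin_len X -> fin_len Y.
Proof. by move=> fs [n ln]; exists n; exact: len_le_surj fs ln. Qed.

Lemma fin_len_iso X Y : iso_mod X Y -> fin_len X -> fin_len Y.
Proof. by move=> [f [g _ gK]]; apply: fin_len_surj => y; exists (g y). Qed.

Lemma fin_len_zero Z : zero_mod Z -> fin_len Z.
Proof.
move=> Z0; exists 0%N, (fun=> 0%N); split=> // S S' [S0 _] _ _ _ x _.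
by rewrite (Z0 x).
Qed.

(** A submodule S is measured by its intersection with X plus its projection to Y. *)
Lemma fin_len_prod X Y : fin_len X -> fin_len Y -> fin_len (X * Y)%type.
Proof.
move=> [n [l lP]] [m [k kP]].
exists (n + m)%N, (fun S => l (fun x => S (x, 0%R)) + k (fun y => exists x, S (x, y)))%N.
have [a aE] := inl_linear X Y.
have sl (S : (X * Y)%type -> Prop) : submod S -> submod (fun x => S (x, 0 : Y)).
  move=> [S0 SP]; split=> // c x y Sx Sy; have := SP c _ _ Sx Sy.
  have -> // : c *: (x, 0) + (y, 0) = (c *: x + y, 0 : Y).
  by congr pair; rewrite /= scaler0 addr0.
have sk (S : (X * Y)%type -> Prop) : submod S -> submod (fun y => exists x : X, S (x, y)).
  move=> [S0 SP]; split=> [|c y y' [x Sx] [x' Sx']]; first by exists 0.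
  by exists (c *: x + x'); exact: (SP c (x, y) (x', y')).
split=> [S sS|S S' sS sS' SS' le [x y] S'xy].
  by apply: leq_add; [apply: lP.1; exact: sl|apply: kP.1; exact: sk].
have ll : (l (fun x => S (x, 0%R)) <= l (fun x => S' (x, 0%R)))%N.
  by apply: (length_mono lP); [exact: sl|exact: sl|move=> z; exact: SS'].
have kk : (k (fun y => exists x, S (x, y)) <= k (fun y => exists x, S' (x, y)))%N.
  by apply: (length_mono kP); [exact: sk|exact: sk|move=> z [t /SS']; exists t].
have l1 : (l (fun x => S' (x, 0%R)) <= l (fun x => S (x, 0%R)))%N.
  by rewrite -(leq_add2r (k (fun y => exists x, S (x, y)))); apply: leq_trans le; rewrite leq_add2l.
have k1 : (k (fun y => exists x, S' (x, y)) <= k (fun y => exists x, S (x, y)))%N.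
  by rewrite -(leq_add2l (l (fun x => S (x, 0%R)))); apply: leq_trans le; rewrite leq_add2r.
have [x' Sx'] := kP.2 _ _ (sk _ sS) (sk _ sS')
  (fun z h => let: ex_intro t St := h in ex_intro _ t (SS' _ St)) k1 y (ex_intro _ x S'xy).
have S'd : S' (x - x', 0).
  have := submodB sS' S'xy (SS' _ Sx').
  have -> // : (x, y) - (x', y) = (x - x', 0).
  by congr pair; rewrite /= subrr.
have Sd := lP.2 _ _ (sl _ sS) (sl _ sS') (fun z => SS' _) l1 (x - x') S'd.
 have := submodD sS Sd Sx'.
have -> // : (x - x', 0) + (x', y) = (x, y).
by congr pair; rewrite /= ?subrK ?add0r.
Qed.

Lemma ffun_cons X n :
  iso_mod {ffun 'I_n.+1 -> X} (X * {ffun 'I_n -> X})%type.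
Proof.
have [f fE] : exists f : {linear {ffun 'I_n.+1 -> X} -> (X * {ffun 'I_n -> X})%type},
    forall x, f x = (x ord0, [ffun i => x (lift ord0 i)]).
  apply: linearize => a x y; congr pair; first by rewrite !ffunE.
  by apply/ffunP => i; rewrite !ffunE.
exists f, (fun z : X * {ffun 'I_n -> X} => [ffun i : 'I_n.+1 => if unlift ord0 i is Some j then z.2 j : X else z.1]).
  move=> x; apply/ffunP => i; rewrite fE ffunE /=.
  by case: unliftP => [j|] -> //; rewrite ffunE.
move=> [x y]; rewrite fE ffunE unlift_none; congr pair.
by apply/ffunP => i; rewrite !ffunE liftK.
Qed.

Lemma fin_len_ffun X n : fin_len X -> fin_len {ffun 'I_n -> X}.
Proof.
move=> lX; elim: n => [|n IH]; first by apply: fin_len_zero => x; apply/ffunP => -[].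
exact: fin_len_iso (iso_sym (ffun_cons _ _)) (fin_len_prod lX IH).
Qed.

Lemma submod_maximal M (P : (M -> Prop) -> Prop) : fin_len M ->
  (forall S, P S -> submod S) -> (exists S, P S) ->
  exists S, P S /\ forall S', P S' -> (forall x, S x -> S' x) -> forall x, S' x -> S x.
Proof.
move=> [n [l [ln lS]]] Psub exP.
have [S [PS Smax]] := bounded_max (u := l) exP (fun t Pt => ln t (Psub t Pt)).
by exists S; split=> // S' PS' SS'; apply: lS => //; [exact: Psub|exact: Psub|exact: Smax].
Qed.

(** Among the spans of finitely many elements of S take a maximal one; adjoining an element of S
    cannot enlarge it. *)
Lemma fin_gen_submod M (S : M -> Prop) : fin_len M -> submod S ->
  exists n (v : 'I_n -> M), (forall i, S (v i)) /\
    forall x, S x -> exists c : 'I_n -> R, x = \sum_(i < n) c i *: v i.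
Proof.
move=> lM sS.
pose span n (v : 'I_n -> M) x := exists c : 'I_n -> R, x = \sum_(i < n) c i *: v i.
have span_sub n (v : 'I_n -> M) : submod (span n v).
  split=> [|a _ _ [c ->] [d ->]].
    by exists (fun=> 0); rewrite big1 // => i _; rewrite scale0r.
  exists (fun i => a * c i + d i); rewrite scaler_sumr -big_split /=.
  by apply: eq_bigr => i _; rewrite scalerDl scalerA.
have [_ [[n [v [vS ->]]] vmax]] := @submod_maximal M
  (fun T => exists n (v : 'I_n -> M), (forall i, S (v i)) /\ T = span n v) lM
  ltac:(by move=> T [n [v [_ ->]]]) ltac:(by exists (span 0%N (fun=> 0)), 0%N, (fun=> 0); split=> // -[]).
exists n, v; split=> // x Sx.
pose w (i : 'I_n.+1) := if unlift ord0 i is Some j then v j else x.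
have wE c : \sum_(i < n.+1) c i *: w i = c ord0 *: x + \sum_(i < n) c (lift ord0 i) *: v i.
  rewrite big_ord_recl /w unlift_none; congr (_ + _).
  by apply: eq_bigr => i _; rewrite liftK.
apply: (vmax (span n.+1 w)).
- exists n.+1, w; split=> // i; rewrite /w; case: unliftP => [j|] _ //.
- move=> y [c ->]; exists (fun i => if unlift ord0 i is Some j then c j else 0).
  rewrite wE unlift_none scale0r add0r.
  by apply: eq_bigr => i _; rewrite liftK.
- exists (fun i => if unlift ord0 i is Some j then 0 else 1).
  rewrite wE unlift_none scale1r big1 ?addr0 // => i _.
  by rewrite liftK scale0r.
Qed.

(** X is the direct sum of the fixed points of e and of its kernel. *)
Lemma indec_idem X (e : {linear X -> X}) : indecomposable X ->
  (forall x, e (e x) = e x) -> (forall x, e x = 0) \/ (forall x, e x = x).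
Proof.
move=> [_ iX] ee.
have [K [k [ki kE]]] := ker_ex e.
have sI : submod (fun x => e x = x).
  by split=> [|a x y ex ey]; rewrite ?linear0 // linearP ex ey.
have [I [j [ji jE]]] := submod_ex sI.
have I1 : iso_mod X (I * K)%type.
  apply: iso_sym; have [h hE] := sum_linear j k.
  apply: (@iso_bij R _ _ h).
    move=> [a b] [a' b']; rewrite !hE /= => E.
    have ej c : e (j c) = j c by apply/jE; exists c.
    have ek c : e (k c) = 0 by apply/kE; exists c.
    have := congr1 e E; rewrite !linearD /= !ej !ek !addr0 => E1.
    by rewrite E1 in E; rewrite (ji _ _ E1) (ki _ _ (addrI _ E)).
  move=> x; have [a aE] := (jE (e x)).1 (ee x).
  have /kE[b bE] : e (x - e x) = 0 by rewrite linearB /= ee subrr.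
  by exists (a, b); rewrite hE /= aE bE addrC subrK.
have [I0|K0] := iX _ _ I1; [left|right] => x.
  by have [a <-] := (jE (e x)).1 (ee x); rewrite (I0 a) linear0.
have /kE[b bE] : e (x - e x) = 0 by rewrite linearB /= ee subrr.
by move: bE; rewrite (K0 b) linear0 => /esym/eqP; rewrite subr_eq0 => /eqP <-.
Qed.

(* Fitting: a power g of f with ker g^2 = ker g and im g^2 = im g splits X. *)
Lemma fitting X (f : {linear X -> X}) : fin_len X -> indecomposable X ->
  (injective f /\ surj f) \/ exists n, forall x, iter n f x = 0.
Proof.
move=> [N [l lP]] iX.
pose P (g : {linear X -> X}) := exists n, forall x, g x = iter n.+1 f x.
pose ker (g : {linear X -> X}) x := g x = 0.
pose im (g : {linear X -> X}) y := exists x, g x = y.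
have sker g : submod (ker g).
  by split=> [|a x y gx gy]; rewrite /ker ?linear0 // linearP gx gy scaler0 addr0.
have sim g : submod (im g).
  split=> [|a _ _ [x <-] [y <-]]; first by exists 0; rewrite linear0.
  by exists (a *: x + y); rewrite linearP.
(* The weight rises when the kernel grows and when the image shrinks. Passing from g to its square
   can only do either, so at maximal weight kernel and image are both stable. *)
have [||g [[n gE] gmax]] := @bounded_max _ P
  (fun g => l (ker g) + (N - l (im g)))%N (N + N)%N.
- by exists f, 0%N.
- by move=> g _; apply: leq_add; [exact: lP.1|exact: leq_subr].
have /gmax le : P (g \o g).
  by exists (n + n.+1)%N => x; rewrite -addSn iterD -!gE.
have lek : (l (ker g) <= l (ker (g \o g)))%N.
  by apply: (length_mono lP) => // x gx; rewrite /ker /= gx linear0.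
have lei : (l (im (g \o g)) <= l (im g))%N.
  by apply: (length_mono lP) => // _ [x <-]; exists (g x).
have kerP x : g (g x) = 0 -> g x = 0.
  apply: (lP.2 (ker g) (ker (g \o g))) => //.
    by move=> y gy; rewrite /ker /= gy linear0.
  rewrite -(leq_add2r (N - l (im g))); apply: leq_trans le.
  by rewrite leq_add2l; apply: leq_sub2l.
have imP x : exists y, g (g y) = g x.
  apply: (lP.2 (im (g \o g)) (im g)) => //; last by exists x.
    by move=> _ [y <-]; exists (g y).
  have lN : (l (im g) <= N)%N by exact: lP.1.
  rewrite -(leq_sub2lE _ lN) -(leq_add2l (l (ker g))).
  by apply: leq_trans le; rewrite leq_add2r.
(* The graph of the projection onto the image of g along its kernel. *)
pose r x y := exists t, y = g t /\ g y = g x.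
have lr : linear_rel r.
  move=> a x _ x' _ [t [-> tE]] [t' [-> tE']]; exists (a *: t + t').
  by rewrite !linearP tE tE'.
have r0 y : r 0 y -> y = 0 by move=> [t [->]]; rewrite linear0 => /kerP.
have [e eP] := linear_of_rel lr (fun x => let: ex_intro t tE := imP x in
  ex_intro _ (g t) (ex_intro _ t (conj erefl tE))) r0.
have ee x : e (e x) = e x.
  apply: (linear_rel_fun lr r0 (eP _)); have [t [-> _]] := eP x.
  by exists t.
have [e0|e1] := indec_idem iX ee; [right|left].
  by exists n.+1 => x; rewrite -gE; have [t [_ <-]] := eP x; rewrite e0 linear0.
have gi x : g x = 0 -> x = 0.
  move=> gx; rewrite -(e1 x); apply: (linear_rel_fun lr r0 (eP _)).
  by exists 0; rewrite !linear0 gx.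
split=> [x y fxy|y].
  apply/eqP; rewrite -subr_eq0; apply/eqP/gi.
  by rewrite linearB /= !gE !iterSr fxy subrr.
have [t [tE _]] := eP y; exists (iter n f t).
by rewrite -iterS -gE -tE e1.
Qed.

Definition krull X : Prop := indecomposable X /\ fin_len X.

(** If f is nilpotent, g is injective, because f fixes every vector of the kernel of g. An injective
    g is not nilpotent on a nonzero module, so Fitting's lemma makes it bijective. *)
Lemma krull_local X (f g : {linear X -> X}) : krull X ->
  (forall x, f x + g x = x) -> (injective f /\ surj f) \/ (injective g /\ surj g).
Proof.
move=> [iX lX] fg; have [|[n fn]] := fitting f lX iX; [by left|right].
have gi : injective g.
  move=> x y /eqP; rewrite -subr_eq0 -linearB => /eqP g0; apply/eqP.
  rewrite -subr_eq0; have := fg (x - y); rewrite g0 addr0 => f1.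
  have E m : iter m f (x - y) = x - y by elim: m => //= m ->.
  by rewrite -(E n) fn.
have [//|[m gm]] := fitting g lX iX; exfalso; apply: iX.1 => x.
have inj_iter k : injective (iter k g) by elim: k => //= k IH u v /gi/IH.
by apply: (inj_iter m); rewrite !gm.
Qed.

(** The endomorphism a (b a)^-1 b of Y is idempotent and nonzero, hence the identity. *)
Lemma indec_retract X Y (a : {linear X -> Y}) (b : {linear Y -> X}) :
  indecomposable Y -> ~ zero_mod X ->
  injective (b \o a) -> surj (b \o a) -> injective a /\ surj a.
Proof.
move=> iY X0 bi bs.
have ai : injective a by move=> x y e; apply: bi; rewrite /= e.
have [e eP] : exists e : {linear Y -> Y}, forall y,
    exists x, b (a x) = b y /\ e y = a x.
  apply: (@linear_of_rel R _ _ (fun y z => exists x, b (a x) = b y /\ z = a x)).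
  - move=> c y _ y' _ [x [e1 ->]] [x' [e2 ->]]; exists (c *: x + x').
    by rewrite !linearP e1 e2.
  - by move=> y; have [x xE] := bs (b y); exists (a x), x.
  - move=> y [x [e ->]]; have : (b \o a) x = (b \o a) 0 by rewrite /= e !linear0.
    by move/bi ->; rewrite linear0.
have ea x : e (a x) = a x.
  by have [x' [E ->]] := eP (a x); congr (a _); apply: bi.
have [|e0|e1] := indec_idem (e := e) iY.
- by move=> y; have [x [_ ->]] := eP y; rewrite ea.
- exfalso; apply: X0 => x; apply: ai; by rewrite -ea e0 linear0.
- by split=> // y; have [x [_ E]] := eP y; exists x; rewrite -E e1.
Qed.

(* Gaussian elimination of the invertible entry [X -> X'] of an isomorphism. *)
Lemma iso_cancel X A X' B (f : {linear (X * A)%type -> (X' * B)%type}) :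
  injective f -> surj f ->
  (forall x, (f (x, 0)).1 = 0 -> x = 0) ->
  (forall y, exists x, (f (x, 0)).1 = y) ->
  iso_mod A B.
Proof.
move=> fi fs f0 fx.
have split_pair (x : X) (a : A) : (x, a) = (x, 0) + (0, a).
  by congr pair => /=; rewrite ?addr0 ?add0r.
apply: (@iso_of_rel R _ _ (fun a b => exists x, f (x, a) = (0, b))).
- move=> c a b a' b' [x e] [x' e']; exists (c *: x + x').
  have -> : (c *: x + x', c *: a + a') = c *: (x, a) + (x', a') by [].
  by rewrite linearP e e'; congr pair; rewrite /= scaler0 addr0.
- move=> a; have [x xE] := fx (- (f (0, a)).1).
  exists (f (x, a)).2, x; rewrite [LHS]surjective_pairing; congr pair.
  by rewrite split_pair linearD /= xE addNr.
- by move=> b [x e]; have /f0 x0 := congr1 fst e; move: e; rewrite x0 linear0 => -[].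
- by move=> b; have [[x a] e] := fs (0, b); exists a, x.
- by move=> a [x e]; have := fi (x, a) 0; rewrite linear0 e => /(_ erefl)[].
Qed.

(** * Exchange, uniqueness of decompositions and multiplicities *)

Fixpoint bsum (s : seq (lmodType R)) : lmodType R :=
  if s is X :: s' then (X * bsum s')%type : lmodType R else zmodule R.

Definition allp (P : lmodType R -> Prop) (s : seq (lmodType R)) : Prop :=
  forall k, (k < size s)%N -> P (nth (zmodule R) s k).

Lemma allp_nil P : allp P [::].
Proof. by []. Qed.

Lemma allp_cons P X s : allp P (X :: s) <-> P X /\ allp P s.
Proof.
split=> [H|[PX Ps] [|k] //]; last exact: Ps.
by split=> [|k]; [exact: (H 0%N)|exact: (H k.+1)].
Qed.

Lemma allp_cat P s t : allp P (s ++ t) <-> allp P s /\ allp P t.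
Proof.
elim: s => [|X s IH] /=; first by split=> // -[].
by rewrite !allp_cons IH; tauto.
Qed.

Lemma allp_impl (P Q : lmodType R -> Prop) s :
  (forall X, P X -> Q X) -> allp P s -> allp Q s.
Proof. by move=> PQ H k /H/PQ. Qed.

Lemma bsum_cat s t : iso_mod (bsum (s ++ t)) (bsum s * bsum t)%type.
Proof.
elim: s => [|X s IH] /=; first exact/iso_sym/iso_prodl0/zmodule0.
exact: iso_trans (iso_prod (iso_refl _) IH) (iso_prodA _ _ _).
Qed.

(** The identity of X is the sum of its components through Y and through [bsum s], and one of them
    is invertible. In the first case X is isomorphic to Y and cancels. In the second, [bsum s]
    splits as X plus the kernel K of g2; cancelling X gives A = Y + K, and induction applies to X +
    K. *)
Lemma krull_exchange X A s : krull X -> allp (@indecomposable R) s ->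
  iso_mod (X * A)%type (bsum s) ->
  exists s1 Y s2, [/\ s = s1 ++ Y :: s2, iso_mod X Y & iso_mod A (bsum (s1 ++ s2))].
Proof.
move=> kX; elim: s A => [|Y s IH] A.
  move=> _ /iso_sym/zero_mod_iso/(_ (zmodule0 R))/zero_mod_prod[X0 _].
  by case: (kX.1.1 X0).
move=> /allp_cons[iY is'] /= /iso_modP[f [g [fK gK]]].
have [a aE] := inl_linear X A.
have [b1 b1E] := inl_linear Y (bsum s); have [b2 b2E] := inr_linear Y (bsum s).
pose f1 : {linear X -> Y} := fst \o (f \o a).
pose f2 : {linear X -> bsum s} := snd \o (f \o a).
pose g1 : {linear Y -> X} := fst \o (g \o b1).
pose g2 : {linear bsum s -> X} := fst \o (g \o b2).
have fi := can_inj fK.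
have fs y : exists x, f x = y by exists (g y).
have fgE x : (g1 \o f1) x + (g2 \o f2) x = x.
  rewrite /= b1E b2E -[_ + _]/((g ((f (a x)).1, 0) + g (0, (f (a x)).2)).1).
  rewrite -linearD /=.
  have -> : ((f (a x)).1, 0) + (0, (f (a x)).2) = f (a x).
    by rewrite [RHS]surjective_pairing; congr pair; rewrite /= ?addr0 ?add0r.
  by rewrite fK aE.
have [[i1 s1]|[i2 s2]] := krull_local kX fgE.
  have [f1i f1s] := indec_retract iY kX.1.1 i1 s1.
  exists [::], Y, s; split=> //=; first exact: iso_bij f1i f1s.
  apply: (iso_cancel fi fs) => [x E|y].
    by apply: f1i; rewrite linear0 /= aE.
  by have [x xE] := f1s y; exists x; rewrite -xE /= aE.
have [K [k [ki kE]]] := ker_ex g2.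
have [p pE] : exists p : {linear bsum s -> K}, forall b,
    exists x, g2 (f2 x) = g2 b /\ k (p b) = b - f2 x.
  apply: (@linear_of_rel R _ _ (fun b y => exists x, g2 (f2 x) = g2 b /\ k y = b - f2 x)).
  - move=> c b y b' y' [x [e1 e2]] [x' [e3 e4]]; exists (c *: x + x').
    by rewrite !linearP e1 e2 e3 e4 scalerDr addrACA.
  - move=> b; have [x xE] := s2 (g2 b); have /kE[y yE] : g2 (b - f2 x) = 0.
      by rewrite linearB /=; move: xE => /= ->; rewrite subrr.
    by exists y, x.
  - move=> y [x [e1 e2]]; apply: ki; rewrite e2 linear0 sub0r.
    have /i2 -> : (g2 \o f2) x = (g2 \o f2) 0 by rewrite linear0 -[LHS]/(g2 (f2 x)) e1 linear0.
    by rewrite linear0 oppr0.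
have [t tE] := pair_linear g2 p.
have ti : injective t.
  move=> b b' /eqP; rewrite -subr_eq0 -linearB tE => /eqP[E1 E2].
  apply/eqP; rewrite -subr_eq0; have [x [e1 e2]] := pE (b - b').
  move: e2; rewrite E2 linear0.
  have /i2 -> : (g2 \o f2) x = (g2 \o f2) 0 by rewrite linear0 -[LHS]/(g2 (f2 x)) e1; exact: E1.
  by rewrite linear0 subr0 => <-.
have ts z : exists b, t b = z.
  case: z => x y; have [x' x'E] := s2 x; exists (f2 x' + k y).
  have gk : g2 (k y) = 0 by apply/kE; exists y.
  have E1 : g2 (f2 x' + k y) = x.
    by rewrite linearD gk addr0; exact: x'E.
  rewrite tE E1; congr pair; have [x2 [e1 e2]] := pE (f2 x' + k y).
  apply: ki; rewrite e2; have /i2 -> : (g2 \o f2) x2 = (g2 \o f2) x' by rewrite -[LHS]/(g2 (f2 x2)) e1 E1 -x'E.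
  by rewrite addrC addKr.
(* f followed by the splitting t of [bsum s], regrouped so that its entry from X to X is the
   invertible g2 o f2. *)
have [u uE] : exists u : {linear (X * A)%type -> (X * (Y * K))%type},
    forall z, u z = ((t (f z).2).1, ((f z).1, (t (f z).2).2)).
  by apply: linearize => c y z; rewrite !linearP.
have ui : injective u.
  move=> y z; rewrite !uE => -[E1 E2 E3]; apply: fi.
  rewrite [LHS]surjective_pairing [RHS]surjective_pairing E2; congr pair.
  by apply: ti; rewrite [LHS]surjective_pairing [RHS]surjective_pairing E1 E3.
have us z : exists y, u y = z.
  case: z => x [y y']; have [b bE] := ts (x, y'); have [w wE] := fs (y, b).
  by exists w; rewrite uE wE /= bE.
have uX x : (u (x, 0)).1 = (g2 \o f2) x by rewrite uE tE /= aE.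
have AYK : iso_mod A (Y * K)%type.
  apply: (iso_cancel ui us) => [x E|y].
    by apply: i2; rewrite [RHS]linear0 -E uX.
  by have [x xE] := s2 y; exists x; rewrite uX.
have XK : iso_mod (X * K)%type (bsum s) by apply/iso_sym; exact: iso_bij ti ts.
have [s1 [Y2 [s3 [sE XY KE]]]] := IH _ is' XK.
exists (Y :: s1), Y2, s3; split=> //; first by rewrite sE.
exact: iso_trans AYK (iso_prod (iso_refl _) KE).
Qed.

Definition iso_count X (s : seq (lmodType R)) : nat :=
  count (fun Y => `[< iso_mod X Y >]) s.

(** The exchange lemma removes the head of s together with an isomorphic member of t, which leaves
    isomorphic complements. *)
Lemma krull_unique X s t : allp krull s -> allp krull t ->
  iso_mod (bsum s) (bsum t) -> iso_count X s = iso_count X t.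
Proof.
elim: s t => [|Y s IH] [|Z t] //.
- move=> _ /allp_cons[[[Z0 _] _] _] /zero_mod_iso/(_ (zmodule0 R))/zero_mod_prod[ZZ _].
  by case: (Z0 ZZ).
- move=> /allp_cons[[[Y0 _] _] _] _ /iso_sym/zero_mod_iso/(_ (zmodule0 R))/zero_mod_prod[YY _].
  by case: (Y0 YY).
move=> /allp_cons[kY ks] kt I.
have [|s1 [Y' [s2 [tE YY' I']]]] := krull_exchange kY _ I.
  by apply: allp_impl kt => ? [].
move: kt; rewrite tE allp_cat allp_cons => -[k1 [_ k2]].
rewrite /= (IH (s1 ++ s2)) ?allp_cat // /iso_count !count_cat /= addnCA; congr (_ + (_ + _))%N.
congr (nat_of_bool _); apply/asboolP/asboolP => XI.
  exact: iso_trans XI YY'.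
exact: iso_trans XI (iso_sym YY').
Qed.

Lemma fin_len_retract X Y (i : {linear X -> Y}) (p : {linear Y -> X}) :
  cancel i p -> fin_len Y -> fin_len X.
Proof. by move=> /can_inj; exact: fin_len_inj. Qed.

Lemma krull_decomposition M : fin_len M ->
  exists s, allp krull s /\ iso_mod M (bsum s).
Proof.
move=> [n]; elim/ltn_ind: n M => n IH M lM.
have [M0|M0] := pselect (zero_mod M).
  by exists [::]; split=> //; exact: iso_zero M0 (zmodule0 R).
have [iM|nM] := pselect (indecomposable M).
  exists [:: M]; split; first by apply/allp_cons; split=> //; split=> //; exists n.
  exact/iso_sym/iso_prodr0/zmodule0.
have [X [Y [I X0 Y0]]] : exists X Y, [/\ iso_mod M (X * Y)%type, ~ zero_mod X & ~ zero_mod Y].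
  apply: contrapT => H; apply: nM; split=> // X Y I.
  have [X0|X0] := pselect (zero_mod X); [by left|right].
  by apply: contrapT => Y0; apply: H; exists X, Y.
have sub Z Z' : iso_mod M (Z * Z')%type -> ~ zero_mod Z' ->
    exists s, allp krull s /\ iso_mod Z (bsum s).
  move=> /iso_sym[f [g fK gK]] Z'0; have [a aE] := inl_linear Z Z'.
  have [m mn /IH] : exists2 m, (m < n)%N & len_le Z m; last exact.
  apply: (@len_le_inj_proper _ _ (f \o a) _ _ _ lM).
    by move=> x y /(can_inj fK); rewrite !aE => -[].
  move=> fs; apply: Z'0 => y; have [x] := fs (f (0, y)).
  by move/(can_inj fK); rewrite aE => -[].
have [s [ks sE]] := sub _ _ I Y0.
have [t [kt tE]] := sub _ _ (iso_trans I (iso_prodC _ _)) X0.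
exists (s ++ t); split; first exact/allp_cat.
exact: iso_trans I (iso_trans (iso_prod sE tE) (iso_sym (bsum_cat _ _))).
Qed.

(* Junk value 0 when M is not a finite sum of modules satisfying [krull]. *)
Definition mult X M : nat :=
  xget 0%N [set k | exists s, [/\ allp krull s, iso_mod M (bsum s) & k = iso_count X s]].

Lemma multE X M s : allp krull s -> iso_mod M (bsum s) -> mult X M = iso_count X s.
Proof.
move=> ks I; rewrite /mult; case: xgetP => [k _ [t [kt J ->]]|/(_ (iso_count X s)) []].
  by apply: krull_unique => //; exact: iso_trans (iso_sym J) I.
by exists s.
Qed.

Lemma mult_iso X M N : fin_len M -> iso_mod M N -> mult X M = mult X N.
Proof.
move=> /krull_decomposition[s [ks I]] J; rewrite (multE X ks I) (multE X ks) //.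
exact: iso_trans (iso_sym J) I.
Qed.

Lemma multD X M N : fin_len M -> fin_len N ->
  mult X (M * N)%type = (mult X M + mult X N)%N.
Proof.
move=> /krull_decomposition[s [ks I]] /krull_decomposition[t [kt J]].
rewrite (multE X ks I) (multE X kt J) (@multE X _ (s ++ t)).
- by rewrite /iso_count count_cat.
- exact/allp_cat.
- exact: iso_trans (iso_prod I J) (iso_sym (bsum_cat _ _)).
Qed.

Lemma mult_krull X Y : krull Y -> mult X Y = `[< iso_mod X Y >].
Proof.
move=> kY; rewrite (@multE X _ [:: Y]) /iso_count /= ?addn0 //.
  by apply/allp_cons; split=> //; exact: allp_nil.
exact/iso_sym/iso_prodr0/zmodule0.
Qed.

Lemma mult_zero X Z : zero_mod Z -> mult X Z = 0%N.
Proof.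
by move=> Z0; rewrite (@multE X _ [::]) //; exact: iso_zero (zmodule0 R).
Qed.

Lemma krull_summand X A s : krull X -> allp (@indecomposable R) s ->
  iso_mod (X * A)%type (bsum s) ->
  exists2 k, (k < size s)%N & iso_mod X (nth (zmodule R) s k).
Proof.
move=> kX ks /(krull_exchange kX ks)[s1 [Y [s2 [-> XY _]]]].
exists (size s1); first by rewrite size_cat /= -[ltnLHS]addn0 ltn_add2l.
by rewrite nth_cat ltnn subnn.
Qed.

End Length.

(** * Bongartz extensions *)

Section Powers.
Variable R : nzRingType.
Implicit Types (X Y Z M N : lmodType R).

Lemma fgproj_ffun X n : fgproj X -> fgproj {ffun 'I_n -> X}.
Proof.
move=> fX; elim: n => [|n IH]; first by apply: fgproj_zero => x; apply/ffunP => -[].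
exact: fgproj_iso (iso_sym (ffun_cons _ _)) (fgproj_prod fX IH).
Qed.

Lemma ext1_zerol Z Y : zero_mod Z -> ext1 Z Y.
Proof. by move=> /(@fgproj_zero R)[_]; exact: ext1_projective. Qed.

Lemma ext1_ffunl X Y n : ext1 X Y -> ext1 {ffun 'I_n -> X} Y.
Proof.
move=> H; elim: n => [|n IH]; first by apply: ext1_zerol => x; apply/ffunP => -[].
exact: ext1_isol (iso_sym (ffun_cons _ _)) (ext1_prodl H IH).
Qed.

Lemma ffun_linear X Y n (f : 'I_n -> {linear X -> Y}) :
  exists g : {linear X -> {ffun 'I_n -> Y}}, forall x, g x = [ffun i => f i x].
Proof.
by apply: linearize => a x y; apply/ffunP => i; rewrite !ffunE linearP.
Qed.

Lemma ffun_map_linear X Y n (f : {linear X -> Y}) :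
  exists g : {linear {ffun 'I_n -> X} -> {ffun 'I_n -> Y}},
    forall x, g x = [ffun i => f (x i)].
Proof.
by apply: linearize => a x y; apply/ffunP => i; rewrite !ffunE linearP.
Qed.

Lemma ffun_sum_linear X Y n (f : 'I_n -> {linear X -> Y}) :
  exists g : {linear {ffun 'I_n -> X} -> Y}, forall x, g x = \sum_i f i (x i).
Proof.
apply: linearize => a x y; rewrite scaler_sumr -big_split /=.
by apply: eq_bigr => i _; rewrite !ffunE linearP.
Qed.

End Powers.

(** A subspace T containing W and maximal among those that avoid v satisfies V = T + K v; theta is
    the coefficient of v. *)
Lemma separation (K : fieldType) (V : lmodType K) (W : V -> Prop) (v : V) :
  fin_len V -> submod W -> ~ W v ->
  exists theta : {linear V -> K^o}, (forall w, W w -> theta w = 0) /\ theta v <> 0.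
Proof.
move=> lV sW Wv.
have [T [[sT WT Tv] Tmax]] := @submod_maximal K V
  (fun S => [/\ submod S, forall w, W w -> S w & ~ S v]) lV
  ltac:(by move=> S []) ltac:(by exists W).
have [theta thetaP] : exists theta : {linear V -> K^o}, forall x, T (x - theta x *: v).
  apply: (@linear_of_rel K _ K^o (fun x k => T (x - k *: v))).
  - move=> c x k x' k' /= Tx Tx'; have := sT.2 c _ _ Tx Tx'; congr T.
    by rewrite scalerBr scalerA addrACA -opprD -scalerDl.
  - move=> x; have [Tx|Tx] := pselect (T x); first by exists 0; rewrite scale0r subr0.
    apply: contrapT => H; apply: Tx.
    apply: (Tmax (fun y => exists k t, T t /\ y = k *: x + t)).
    + split.
      * split=> [|a _ _ [k [t [Tt ->]]] [k' [t' [Tt' ->]]]].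
          by exists 0, 0; split; [exact: sT.1|rewrite scale0r addr0].
        exists (a * k + k'), (a *: t + t'); split; first exact: sT.2.
        by rewrite scalerDr scalerDl scalerA addrACA.
      * by move=> w /WT Tw; exists 0, w; rewrite scale0r add0r.
      * move=> [k [t [Tt vE]]]; have [k0|k0] := eqVneq k 0.
          by apply: Tv; rewrite vE k0 scale0r add0r.
        apply: H; exists k^-1; rewrite vE scalerDr scalerA mulVf // scale1r.
        rewrite opprD addrA subrr add0r; apply: submodN => //.
        exact: submodZ.
    + by move=> y Ty; exists 0, y; rewrite scale0r add0r.
    + by exists 1, 0; split; [exact: sT.1|rewrite scale1r addr0].
  - move=> k; rewrite sub0r => Tk; apply/eqP/negPn/negP => k0; apply: Tv.
    have := submodZ sT (- k^-1) Tk.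
    by rewrite scalerN scaleNr opprK scalerA mulVf // scale1r.
exists theta; split=> [w Ww|theta0]; last first.
  by apply: Tv; have := thetaP v; rewrite theta0 scale0r subr0.
apply/eqP/negPn/negP => k0; apply: Tv.
have := submodB sT (WT _ Ww) (thetaP w); rewrite opprB addrC subrK => Tk.
by have := submodZ sT (theta w)^-1 Tk; rewrite scalerA mulVf // scale1r.
Qed.

(** Restriction of scalars along z. A ring morphism from K stands in for an algebra structure, since
    [A^c] is used as a ring only; this serves A and [A^c] alike. *)
Definition res (K : fieldType) (R : nzRingType) (z : {rmorphism K -> R})
  (M : lmodType R) : Type := M.

Section Restriction.
Variables (K : fieldType) (R : nzRingType) (z : {rmorphism K -> R}).
Section Structure.
Variable M : lmodType R.
HB.instance Definition _ := GRing.Zmodule.copy (res z M) M.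
Definition res_scale (k : K) (x : res z M) : res z M := z k *: (x : M).
Fact res_scaleA a b x : res_scale a (res_scale b x) = res_scale (a * b) x.
Proof. by rewrite /res_scale scalerA rmorphM. Qed.
Fact res_scale1 : left_id 1 res_scale.
Proof. by move=> x; rewrite /res_scale rmorph1 scale1r. Qed.
Fact res_scaleDr : right_distributive res_scale +%R.
Proof. by move=> a x y; exact: scalerDr. Qed.
Fact res_scaleDl x : {morph res_scale^~ x : a b / a + b}.
Proof. by move=> a b; rewrite /res_scale rmorphD; exact: scalerDl. Qed.
HB.instance Definition _ := GRing.Zmodule_isLmodule.Build K (res z M)
  res_scaleA res_scale1 res_scaleDr res_scaleDl.
Lemma res_scaleE k (x : res z M) : k *: x = z k *: (x : M).
Proof. by []. Qed.
End Structure.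

Definition spanning n (b : 'I_n -> R) : Prop :=
  forall a, exists c : 'I_n -> K, a = \sum_(i < n) z (c i) * b i.
Variables (d : nat) (bas : 'I_d -> R).
Implicit Types (M L P Q E : lmodType R).
Hypothesis b_span : spanning bas.

Lemma fin_len_field : @fin_len K K^o.
Proof.
exists 1%N, (fun S => `[< exists x : K^o, S x /\ x != 0 >] : nat).
split=> [S _|S S' sS sS' SS' le x S'x]; first exact: leq_b1.
have [->|x0] := eqVneq x 0; first exact: sS.1.
move: le; rewrite (asboolT (ex_intro _ x (conj S'x x0))).
case: asboolP => // -[y [Sy y0]] _.
by have := submodZ sS (x / y) Sy; rewrite -[_ *: _]/(x / y * y) divfK.
Qed.

Lemma fin_len_res M : fin_gen M -> @fin_len K (res z M).
Proof.
move=> [m [v /free_cover[p [ps _]]]].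
have lR : @fin_len K (res z R^o).
  have [q [qs _]] := @free_cover K (res z R^o) d bas b_span.
  exact: fin_len_surj qs (fin_len_ffun _ fin_len_field).
have [q qE] : exists q : {linear {ffun 'I_m -> res z R^o} -> res z M},
    forall x, q x = p x.
  apply: linearize => k x y.
  have -> : k *: x + y = z k *: (x : {ffun 'I_m -> R^o}) + y.
    by apply/ffunP => i; rewrite !ffunE.
  exact: linearP.
apply: (fin_len_surj (f := q)) (fin_len_ffun _ lR) => y.
by have [x xE] := ps y; exists x; rewrite qE.
Qed.

Hypothesis z_central : forall k a, z k * a = a * z k.

Lemma fin_gen_len M : fin_gen M -> fin_len M.
Proof.
move=> /fin_len_res[m [l [lm lS]]]; exists m, l.
have sub (S : M -> Prop) : submod S -> submod (S : res z M -> Prop).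
  by move=> [S0 SP]; split=> // k x y; exact: SP.
split=> [S /sub/lm //|S S' sS sS' SS'].
exact: lS (sub _ sS) (sub _ sS') SS'.
Qed.

(** Evaluation at m generators of L identifies Hom(L, Q) with a subspace of Q^m, which has finite
    length over K. Centrality of z makes it closed under the scalars. *)
Lemma hom_fin_gen L Q : fin_gen L -> fin_gen Q ->
  exists r (h : 'I_r -> {linear L -> Q}), forall f : {linear L -> Q},
    exists c : 'I_r -> K, forall x, f x = \sum_(t < r) z (c t) *: h t x.
Proof.
move=> [m [v vP]] fQ.
have scaleC k a (x : Q) : z k *: (a *: x) = a *: (z k *: x).
  by rewrite !scalerA z_central.
pose S (w : {ffun 'I_m -> res z Q}) :=
  exists f : {linear L -> Q}, forall i, w i = f (v i).
have sS : submod S.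
  split=> [|k x y [f fE] [g gE]]; first by exists \0 => i; rewrite ffunE.
  have [h hE] : exists h : {linear L -> Q}, forall x, h x = z k *: f x + g x.
    apply: linearize => a u u'.
    by rewrite !linearP !scalerDr scaleC addrACA.
  by exists h => i; rewrite !ffunE hE -fE -gE.
have [r [w [wS wP]]] := fin_gen_submod (fin_len_ffun m (fin_len_res fQ)) sS.
have [h hE] := choice wS.
exists r, h => f.
have [c cE] := wP [ffun i => f (v i)] (ex_intro _ f (ffunE _)).
exists c => x; have [a ->] := vP x.
rewrite linear_sum; under [RHS]eq_bigr do rewrite linear_sum scaler_sumr.
rewrite exchange_big; apply: eq_bigr => i _ /=.
have /ffunP/(_ i) := cE; rewrite ffunE sum_ffunE linearZ /= => ->.
rewrite scaler_sumr; apply: eq_bigr => t _.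
by rewrite linearZ /= scaleC ffunE -hE.
Qed.

(* Bongartz: the extension [0 -> P -> E -> M^r -> 0] is universal, i.e. the    *)
(* connecting map Hom(M, M^r) -> Ext^1(M, P) is onto.                          *)
Lemma bongartz M P : pd1 M -> ext1 M M -> fgproj P ->
  exists E r (a : {linear P -> E}) (b : {linear E -> {ffun 'I_r -> M}}),
    [/\ ses a b, pd1 E & ext1 M E].
Proof.
move=> [L [Q [i [p [sip fL fQ]]]]] eMM fP; have pi0 := ses_comp0 sip.
have [ii ps ip] := sip.
have [r [h hP]] := hom_fin_gen fL.1 fP.1.
have [h' h'E] := ffun_sum_linear h.
have [i' i'E] := ffun_map_linear r i.
(* E is the cokernel of L^r -> P x Q^r, that is, the pushout of L^r -> Q^r along the map with
   components h t, which span Hom(L, P). *)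
have [j jE] := pair_linear h' i'.
have i'i : injective i'.
  move=> x y /ffunP e; apply/ffunP => t; apply: ii.
  by have := e t; rewrite !i'E !ffunE.
have ji : injective j by move=> x y; rewrite !jE => -[_ /i'i].
have [E [c sjc]] := ses_coker ji; have [_ cs jc] := sjc.
have [a1 a1E] := inl_linear P {ffun 'I_r -> Q}.
have [a2 a2E] := inr_linear P {ffun 'I_r -> Q}.
have [p' p'E] := ffun_map_linear r p.
have p'0 x : p' (i' x) = 0.
  by apply/ffunP => t; rewrite p'E !ffunE i'E ffunE pi0.
have [b bE] : exists b : {linear E -> {ffun 'I_r -> M}}, forall w, b (c w) = p' w.2.
  have [b bP] : exists b : {linear E -> {ffun 'I_r -> M}}, forall x,
      exists w, c w = x /\ b x = p' w.2.
    apply: (@linear_of_rel R _ _ (fun x y => exists w, c w = x /\ y = p' w.2)).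
    - move=> k _ y _ y' [w [<- ->]] [w' [<- ->]]; exists (k *: w + w').
      by rewrite !linearP.
    - by move=> x; have [w wE] := cs x; exists (p' w.2), w.
    - by move=> y [w [/jc[x <-] ->]]; rewrite jE p'0.
  exists b => w; have [w' [/eqP e1 ->]] := bP (c w); move: e1.
  rewrite -subr_eq0 -linearB => /eqP/jc[x]; rewrite jE => /(congr1 snd) /= E1.
  by apply/eqP; rewrite -subr_eq0 -linearB -E1 p'0.
have swap x : c (a1 (h' x)) = - c (a2 (i' x)).
  apply/eqP; rewrite -addr_eq0 -linearD; apply/eqP/jc; exists x.
  by rewrite jE a1E a2E; congr pair; rewrite /= ?addr0 ?add0r.
have sab : ses (c \o a1) b.
  split.
  - move=> x y /eqP; rewrite -subr_eq0 -linearB => /eqP/jc[l].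
    rewrite jE a1E => -[E1 E2]; apply/eqP; rewrite -subr_eq0 -E1.
    suff -> : l = 0 by rewrite linear0.
    by apply: i'i; rewrite E2 linear0.
  - move=> y; have [w wE] : exists w : {ffun 'I_r -> Q}, forall t, p (w t) = y t.
      have [w wE] := choice (fun t => ps (y t)).
      by exists [ffun t => w t] => t; rewrite ffunE.
    exists (c (0, w)); rewrite bE p'E; apply/ffunP => t.
    by rewrite ffunE wE.
  - move=> y; split=> [|[x <-]]; last by rewrite /= bE a1E linear0.
    have [w <-] := cs y; rewrite bE => w0.
    have [x xE] : exists x, i' x = w.2.
      have /choice[x xE] t : exists x, i x = w.2 t.
        by apply/ip; move/ffunP: w0 => /(_ t); rewrite p'E !ffunE.
      by exists [ffun t => x t]; apply/ffunP => t; rewrite i'E !ffunE.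
    exists (w.1 - h' x); rewrite /= linearB linearB /= swap opprK -linearD xE.
    by congr (c _); rewrite a1E a2E [RHS]surjective_pairing; congr pair; rewrite /= ?addr0 ?add0r.
exists E, r, (c \o a1), b; split=> //.
  exists {ffun 'I_r -> L}, (P * {ffun 'I_r -> Q})%type, j, c; split=> //.
    exact: fgproj_ffun.
  exact: fgproj_prod fP (fgproj_ffun _ fQ).
(* Universality: f is a combination of the h t, and [swap] moves each h t, up to sign, to the
   inclusion i, which extends over Q. *)
have stepA (f : {linear L -> P}) :
    exists g : {linear Q -> E}, forall l, c (a1 (f l)) = g (i l).
  have [k kE] := hP f.
  have [g gE] : exists g : {linear Q -> {ffun 'I_r -> Q}},
      forall x, g x = [ffun t => z (k t) *: x].
    apply: linearize => u x y; apply/ffunP => t; rewrite !ffunE.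
    by rewrite scalerDr !scalerA z_central.
  exists (\- (c \o (a2 \o g))) => l.
  have := swap [ffun t => z (k t) *: l]; rewrite h'E.
  have -> : \sum_t h t ([ffun t0 => z (k t0) *: l] t) = f l.
    by rewrite kE; apply: eq_bigr => t _; rewrite ffunE linearZ.
  move=> ->; rewrite /=; congr (- c (a2 _)).
  by rewrite i'E gE; apply/ffunP => t; rewrite !ffunE linearZ.
(* By Ext^1(M, M) = 0, u agrees modulo L^r with a map n' that extends over Q. The difference w takes
   values in L^r, so [swap] carries it to P, where [stepA] applies. *)
have stepB (u : {linear L -> {ffun 'I_r -> Q}}) :
    exists g : {linear Q -> E}, forall l, c (a2 (u l)) = g (i l).
  have /choice[n nE] t : exists n : {linear Q -> Q}, forall l, p (n (i l)) = p (u l t).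
    have [e eE] := ffun_coord Q t.
    have [m mE] := eMM _ _ _ _ sip (p \o (e \o u)).
    have [n nE] := fQ.2 _ _ p m ps; exists n => l.
    by rewrite nE mE /= eE.
  have [n' n'E] := ffun_linear n.
  have [w wE] : exists w : {linear L -> {ffun 'I_r -> L}},
      forall l, i' (w l) = u l - n' (i l).
    have [|w wE] := @projective_lift R L _ _ i' (u \- (n' \o i)) fL.2.
    - move=> l; have /choice[x xE] t : exists x, i x = u l t - n t (i l).
        by apply/ip; rewrite linearB /= nE subrr.
      by exists [ffun t => x t]; apply/ffunP => t; rewrite i'E !ffunE xE /= n'E !ffunE.
    - by exists w.
  have [g gE] := stepA (h' \o w).
  exists ((c \o (a2 \o n')) \- g) => l /=.
  rewrite -gE /= swap opprK wE -linearD -linearD; congr (c (a2 _)).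
  by rewrite addrC subrK.
apply: (ext1_presentation fQ.2 ip ps) => f _.
have [f' f'E] := fL.2 _ _ c f cs.
have [g gE] := stepA (fst \o f'); have [g' g'E] := stepB (snd \o f').
exists (g \+ g') => l /=; rewrite -gE -g'E -linearD /= -f'E; congr (c _).
rewrite a1E a2E [LHS]surjective_pairing.
by congr pair; rewrite /= ?addr0 ?add0r.
Qed.

End Restriction.

(** * Counting the summands of a tilting module *)

Section Additive.
Variable R : nzRingType.
Hypothesis fin_gen_len : forall X : lmodType R, fin_gen X -> fin_len X.
Implicit Types (A B C L P Q U V X Y Z M N : lmodType R).

Definition noniso n (F : 'I_n -> lmodType R) : Prop :=
  forall i j, iso_mod (F i) (F j) -> i = j.

Definition add_closure n (F : 'I_n -> lmodType R) X : Prop :=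
  exists s, iso_mod X (bsum s) /\ allp (fun Y => exists i, iso_mod Y (F i)) s.

Lemma add_closure_gen n (F : 'I_n -> lmodType R) i : add_closure F (F i).
Proof.
exists [:: F i]; split; first exact/iso_sym/iso_prodr0/zmodule0.
by apply/allp_cons; split=> //; exists i; exact: iso_refl.
Qed.

Lemma add_closure_iso n (F : 'I_n -> lmodType R) X Y :
  iso_mod X Y -> add_closure F X -> add_closure F Y.
Proof. by move=> I [s [J sF]]; exists s; split=> //; exact: iso_trans (iso_sym I) J. Qed.

Lemma add_closure_prod n (F : 'I_n -> lmodType R) X Y :
  add_closure F X -> add_closure F Y -> add_closure F (X * Y)%type.
Proof.
move=> [s [I sF]] [t [J tF]]; exists (s ++ t); split; last exact/allp_cat.
exact: iso_trans (iso_prod I J) (iso_sym (bsum_cat _ _)).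
Qed.

Lemma add_closure_zero n (F : 'I_n -> lmodType R) Z : zero_mod Z -> add_closure F Z.
Proof. by move=> Z0; exists [::]; split=> //; exact: iso_zero (zmodule0 R). Qed.

Lemma add_closure_ffun n (F : 'I_n -> lmodType R) X k :
  add_closure F X -> add_closure F {ffun 'I_k -> X}.
Proof.
move=> aX; elim: k => [|k IH]; first by apply: add_closure_zero => x; apply/ffunP => -[].
exact: add_closure_iso (iso_sym (ffun_cons _ _)) (add_closure_prod aX IH).
Qed.

Lemma add_closure_ind n (F : 'I_n -> lmodType R) (C : lmodType R -> Prop) :
  (forall X Y, iso_mod X Y -> C X -> C Y) -> (forall Z, zero_mod Z -> C Z) ->
  (forall X Y, C X -> C Y -> C (X * Y)%type) -> (forall i, C (F i)) ->
  forall X, add_closure F X -> C X.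
Proof.
move=> Ciso C0 CD CF X [s [I sF]]; apply: (Ciso _ _ (iso_sym I)).
elim: s {I} sF => [|Y s IH] /=; first by move=> _; exact: C0 (zmodule0 R).
move=> /allp_cons[[i YF] /IH Cs]; apply: CD => //.
exact: Ciso (iso_sym YF) (CF i).
Qed.

Lemma bsum_nth s k : (k < size s)%N ->
  exists A, iso_mod (nth (zmodule R) s k * A)%type (bsum s).
Proof.
elim: s k => [|X s IH] [|k] //= ks; first by exists (bsum s); exact: iso_refl.
have [A I] := IH _ ks; exists (X * A)%type.
exact: iso_trans (iso_prodCA _ _ _) (iso_prod (iso_refl _) I).
Qed.

Lemma krull_add_closure n (F : 'I_n -> lmodType R) X A :
  (forall i, krull (F i)) -> krull X -> add_closure F (X * A)%type ->
  exists i, iso_mod X (F i).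
Proof.
move=> kF kX [s [I sF]]; have [|k ks J] := krull_summand kX _ I.
  by apply: allp_impl sF => Y [i /iso_sym J]; exact: indec_iso J (kF i).1.
by have [i iE] := sF k ks; exists i; exact: iso_trans J iE.
Qed.

(** By Krull-Schmidt the finite direct sums of the F i are already closed under direct summands. *)
Lemma add_closure_summand n (F : 'I_n -> lmodType R) X Y :
  (forall i, krull (F i)) -> fin_len X ->
  add_closure F (X * Y)%type -> add_closure F X.
Proof.
move=> kF /krull_decomposition[s [ks I]] aXY; exists s; split=> // k lk.
have [A J] := bsum_nth lk.
apply: (krull_add_closure (A := (A * Y)%type) kF (ks k lk)).
apply: add_closure_iso aXY; apply: iso_trans (iso_sym (iso_prodA _ _ _)).
exact: iso_prod (iso_trans I (iso_sym J)) (iso_refl _).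
Qed.

Definition mult_vec n (F : 'I_n -> lmodType R) X : 'rV[int]_n :=
  \row_j (mult (F j) X)%:R.

Section MultVec.
Variables (n : nat) (F : 'I_n -> lmodType R).

Lemma mult_vec_iso X Y : fin_len X -> iso_mod X Y -> mult_vec F X = mult_vec F Y.
Proof. by move=> lX I; apply/rowP => j; rewrite !mxE (mult_iso _ lX I). Qed.

Lemma mult_vecD X Y : fin_len X -> fin_len Y ->
  mult_vec F (X * Y)%type = mult_vec F X + mult_vec F Y.
Proof. by move=> lX lY; apply/rowP => j; rewrite !mxE multD // natrD. Qed.

Lemma mult_vec_zero Z : zero_mod Z -> mult_vec F Z = 0.
Proof. by move=> Z0; apply/rowP => j; rewrite !mxE mult_zero. Qed.

Lemma mult_vec_gen i : (forall i, krull (F i)) -> noniso F ->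
  mult_vec F (F i) = delta_mx 0 i.
Proof.
move=> kF nF; apply/rowP => j; rewrite !mxE mult_krull // eqxx /=.
by case: asboolP => [/nF ->|]; case: eqP => // -> []; exact: iso_refl.
Qed.

(** An additive invariant on finite sums of the F i is the multiplicity vector times the matrix of
    its values on the F i. The invariant is a relation because it is read off from a chosen
    (co)resolution; uniqueness is shown separately. *)
Lemma additive_rel_mult m (r : lmodType R -> 'rV[int]_m -> Prop) (G : 'M[int]_(n, m)) :
  (forall i, krull (F i)) -> noniso F ->
  (forall X Y v, iso_mod X Y -> r X v -> r Y v) ->
  (forall Z, zero_mod Z -> r Z 0) ->
  (forall X Y v w, r X v -> r Y w -> r (X * Y)%type (v + w)) ->
  (forall i, r (F i) (row i G)) ->
  forall X, add_closure F X -> r X (mult_vec F X *m G).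
Proof.
move=> kF nF riso r0 rD rF X.
move=> aX; suff [] : fin_len X /\ r X (mult_vec F X *m G) by [].
apply: (@add_closure_ind n F (fun X => fin_len X /\ r X (mult_vec F X *m G))) aX.
- move=> Y Z I [lY rY]; split; first exact: fin_len_iso I lY.
  by rewrite -(mult_vec_iso lY I); exact: riso I rY.
- by move=> Z Z0; split; [exact: fin_len_zero|rewrite mult_vec_zero // mul0mx; exact: r0].
- move=> Y Z [lY rY] [lZ rZ]; split; first exact: fin_len_prod.
  by rewrite mult_vecD // mulmxDl; exact: rD.
- by move=> i; split; [exact: (kF i).2|rewrite mult_vec_gen // -rowE].
Qed.
End MultVec.

(** With l a lift of p to B, the map (a, l) : A x Q -> B is onto with kernel L. A resolution of C
    thus yields one of B. *)
Lemma ses_pullback A B C L Q (a : {linear A -> B}) (b : {linear B -> C})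
    (i : {linear L -> Q}) (p : {linear Q -> C}) :
  ses a b -> ses i p -> projective Q ->
  exists (j : {linear L -> (A * Q)%type}) (q : {linear (A * Q)%type -> B}), ses j q.
Proof.
move=> sab sip pQ; have [ai bs ab] := sab; have [ii ps ip] := sip.
have [l lE] := pQ _ _ b p bs.
have [q qE] := sum_linear a l.
have [j jE] : exists j : {linear L -> (A * Q)%type},
    forall x, q (j x) = 0 /\ (j x).2 = i x.
  apply: (@linear_of_rel R _ _ (fun x y => q y = 0 /\ y.2 = i x)).
  - move=> c x y x' y' [e1 e2] [e3 e4].
    by rewrite !linearP e1 e3 /= e2 e4 scaler0 addr0.
  - move=> x; have /ab[u uE] : b (l (i x)) = 0 by rewrite lE (ses_comp0 sip).
    by exists (- u, i x); rewrite qE /= linearN uE addNr.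
  - move=> [u y] /= [+ yE]; rewrite qE yE !linear0 /= addr0 => u0.
    by rewrite (ai u 0) // u0 linear0.
exists j, q; split.
- by move=> x y e; apply: ii; rewrite -!(jE _).2 e.
- move=> x; have [y yE] := ps (b x).
  have /ab[u uE] : b (x - l y) = 0 by rewrite linearB /= lE yE subrr.
  by exists (u, y); rewrite qE /= uE subrK.
- move=> [u y]; split=> [q0|[x <-]]; last by case: (jE x).
  have E := q0; rewrite qE /= in E.
  have /ip[x xE] : p y = 0.
    by have := congr1 b E; rewrite linearD linear0 /= (ses_comp0 sab) add0r lE.
  exists x; have [e1 e2] := jE x; apply/eqP; rewrite -subr_eq0; apply/eqP.
  have e3 : (j x - (u, y)).2 = 0 by rewrite /= e2 xE subrr.
  have : q (j x - (u, y)) = 0 by rewrite linearB /= e1 q0 subrr.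
  rewrite qE e3 linear0 addr0 -(linear0 a) => /ai e4.
  by rewrite [LHS]surjective_pairing e3 e4.
Qed.

(** Dual to [ses_pullback]: Ext^1(C, U) = 0 extends a to s : B -> U, and (s, p) : B -> U x C is
    injective with cokernel V. *)
Lemma ses_pushout A B C U V (i : {linear A -> B}) (p : {linear B -> C})
    (a : {linear A -> U}) (b : {linear U -> V}) :
  ses i p -> ses a b -> ext1 C U ->
  exists (j : {linear B -> (U * C)%type}) (q : {linear (U * C)%type -> V}), ses j q.
Proof.
move=> sip sab eCU; have [ai bs ab] := sab; have [ii ps ip] := sip.
have [s sE] := eCU _ _ _ _ sip a.
have [j jE] := pair_linear s p.
have wd x y : p x = p y -> b (s x) = b (s y).
  move/eqP; rewrite -subr_eq0 -linearB => /eqP/ip[u uE].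
  apply/eqP; rewrite -subr_eq0 -!linearB -uE sE.
  by rewrite (ses_comp0 sab).
have [q qP] : exists q : {linear (U * C)%type -> V}, forall z,
    exists x, p x = z.2 /\ q z = b (z.1 - s x).
  apply: (@linear_of_rel R _ _ (fun z v => exists x, p x = z.2 /\ v = b (z.1 - s x))).
  - move=> c z _ z' _ [x [e1 ->]] [x' [e2 ->]]; exists (c *: x + x').
    rewrite !linearP e1 e2; split=> //=; rewrite -linearP; congr (b _).
    by rewrite scalerDr addrACA.
  - by move=> z; have [x xE] := ps z.2; exists (b (z.1 - s x)), x.
  - move=> y [x [/= e ->]]; rewrite sub0r linearN (wd x 0) ?linear0 ?oppr0 //.
have qE x z : p x = z.2 -> q z = b (z.1 - s x).
  move=> e; have [y [e' ->]] := qP z; rewrite !linearB; congr (_ - _).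
  by apply: wd; rewrite e'.
exists j, q; split.
- move=> x y; rewrite !jE => -[e1 e2]; apply/eqP; rewrite -subr_eq0.
  have /ip[u uE] : p (x - y) = 0 by rewrite linearB /= e2 subrr.
  have : s (x - y) = 0 by rewrite linearB /= e1 subrr.
  by rewrite -uE sE -(linear0 a) => /ai ->; rewrite linear0.
- move=> v; have [u uE] := bs v; exists (u, 0).
  have -> : q (u, 0) = b ((u, 0 : C).1 - s 0) by apply: qE; rewrite linear0.
  by rewrite [s 0]linear0 subr0.
- move=> [u y]; split=> [|[x]]; last first.
    by rewrite jE => -[<- <-]; rewrite (qE x) //= subrr linear0.
  have [x [/= e ->]] := qP (u, y) => /ab[w wE]; exists (x + i w).
  by rewrite jE !linearD /= sE wE (ses_comp0 sip) addr0 addrC subrK e.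
Qed.

(** * Classes with respect to projectives and to a tilting family *)

Section Count.
Variables (n m : nat) (P : 'I_n -> lmodType R) (T : 'I_m -> lmodType R).
Hypotheses (P_krull : forall j, krull (P j)) (P_noniso : noniso P).
Hypotheses (T_krull : forall i, krull (T i)) (T_noniso : noniso T).
Hypotheses (P_fgproj : forall j, fgproj (P j)).
Hypothesis P_add : forall Q, fgproj Q -> add_closure P Q.
Hypotheses (T_pd1 : forall i, pd1 (T i)) (T_ext1 : forall i j, ext1 (T i) (T j)).
Hypothesis P_cores : forall j, exists U V (a : {linear P j -> U}) (b : {linear U -> V}),
  [/\ ses a b, add_closure T U & add_closure T V].

Let fgproj_len Q : fgproj Q -> fin_len Q.
Proof. by move=> [/fin_gen_len]. Qed.

Lemma add_closure_fin_len X : add_closure T X -> fin_len X.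
Proof.
apply: add_closure_ind.
- by move=> ? ?; exact: fin_len_iso.
- by move=> ?; exact: fin_len_zero.
- by move=> ? ?; exact: fin_len_prod.
- by move=> i; case: (T_krull i).
Qed.

Lemma add_closure_ext1 X Y : add_closure T X -> add_closure T Y -> ext1 X Y.
Proof.
move=> aX aY; move: X aX; apply: add_closure_ind.
- by move=> ? ? I; exact: ext1_isol I.
- by move=> ? ?; exact: ext1_zerol.
- by move=> ? ?; exact: ext1_prodl.
move=> i; move: Y aY; apply: add_closure_ind => //.
- by move=> ? ? I; exact: ext1_isor I.
- move=> Z Z0 A B a b _ f; exists \0 => x.
  by rewrite (Z0 (f x)).
- by move=> ? ?; exact: ext1_prodr.
Qed.

(* The class [P0] - [P1] of X in the Grothendieck group of projectives.        *)
Definition g_vector X (v : 'rV[int]_n) : Prop :=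
  exists L Q (i : {linear L -> Q}) (p : {linear Q -> X}),
    [/\ ses i p, fgproj L, fgproj Q & v = mult_vec P Q - mult_vec P L].

(* The class [T0] - [T1] of X in the split Grothendieck group of add T.        *)
Definition t_vector X (v : 'rV[int]_m) : Prop :=
  exists U V (a : {linear X -> U}) (b : {linear U -> V}),
    [/\ ses a b, add_closure T U, add_closure T V & v = mult_vec T U - mult_vec T V].

Lemma g_vector_unique X v w : g_vector X v -> g_vector X w -> v = w.
Proof.
move=> [L [Q [i [p [s fL fQ ->]]]]] [L' [Q' [i' [p' [s' fL' fQ' ->]]]]].
have [_ ps _] := s; have [_ ps' _] := s'.
have [h hE] := fQ.2 _ _ p' p ps'; have [k kE] := fQ'.2 _ _ p p' ps.
have := mult_vec_iso P (fgproj_len (fgproj_prod fL fQ')) (schanuel s s' hE kE).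
rewrite !mult_vecD; try exact: fgproj_len.
move=> E; apply/eqP; rewrite subr_eq addrAC eq_sym subr_eq.
by rewrite [X in X == _]addrC E addrC.
Qed.

(** The vanishing of Ext^1 on add T extends each embedding of X along the other, which supplies the
    two maps of the dual Schanuel lemma. *)
Lemma t_vector_unique X v w : t_vector X v -> t_vector X w -> v = w.
Proof.
move=> [U [V [a [b [s aU aV ->]]]]] [U' [V' [a' [b' [s' aU' aV' ->]]]]].
have [h hE] := add_closure_ext1 aV aU' s a'.
have [k kE] := add_closure_ext1 aV' aU s' a.
have := mult_vec_iso T (add_closure_fin_len (add_closure_prod aU aV')) (coschanuel s s' hE kE).
rewrite !mult_vecD; try exact: add_closure_fin_len.
move=> E; apply/eqP; rewrite subr_eq addrAC eq_sym subr_eq.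
by rewrite -E.
Qed.

Lemma g_vector_iso X Y v : iso_mod X Y -> g_vector X v -> g_vector Y v.
Proof.
move=> I [L [Q [i [p [s fL fQ ->]]]]]; have [p' s'] := ses_isor I s.
by exists L, Q, i, p'.
Qed.

Lemma t_vector_iso X Y v : iso_mod X Y -> t_vector X v -> t_vector Y v.
Proof.
move=> I [U [V [a [b [s aU aV ->]]]]]; have [a' s'] := ses_isol I s.
by exists U, V, a', b.
Qed.

Lemma ses_idr X Z : zero_mod Z -> ses (\0 : {linear Z -> X}) (@idfun X).
Proof.
move=> Z0; split=> [x y _|x|x]; [by rewrite (Z0 x) (Z0 y)|by exists x|].
by split=> [/= ->|[y <-] //]; exists 0.
Qed.

Lemma ses_idl X Z : zero_mod Z -> ses (@idfun X) (\0 : {linear X -> Z}).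
Proof.
move=> Z0; split=> [x y //|x|x]; first by exists 0; rewrite (Z0 x).
by split=> // _; exists x.
Qed.

Lemma g_vector_proj Q : fgproj Q -> g_vector Q (mult_vec P Q).
Proof.
move=> fQ; exists (zmodule R), Q, \0, idfun; split=> //.
- exact: ses_idr (zmodule0 R).
- exact: fgproj_zero (zmodule0 R).
- by rewrite (mult_vec_zero _ (zmodule0 R)) subr0.
Qed.

Lemma t_vector_add X : add_closure T X -> t_vector X (mult_vec T X).
Proof.
move=> aX; exists X, (zmodule R), idfun, \0; split=> //.
- exact: ses_idl (zmodule0 R).
- exact: add_closure_zero (zmodule0 R).
- by rewrite (mult_vec_zero _ (zmodule0 R)) subr0.
Qed.

Lemma g_vectorD X Y v w :
  g_vector X v -> g_vector Y w -> g_vector (X * Y)%type (v + w).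
Proof.
move=> [L [Q [i [p [s fL fQ ->]]]]] [L' [Q' [i' [p' [s' fL' fQ' ->]]]]].
have [j [q sq]] := ses_prod s s'.
exists (L * L')%type, (Q * Q')%type, j, q; split; rewrite ?mult_vecD //;
  try (exact: fgproj_len); try exact: fgproj_prod.
by rewrite opprD addrACA.
Qed.

Lemma t_vectorD X Y v w :
  t_vector X v -> t_vector Y w -> t_vector (X * Y)%type (v + w).
Proof.
move=> [U [V [a [b [s aU aV ->]]]]] [U' [V' [a' [b' [s' aU' aV' ->]]]]].
have [j [q sq]] := ses_prod s s'.
exists (U * U')%type, (V * V')%type, j, q; split; rewrite ?mult_vecD //;
  try (exact: add_closure_fin_len); try exact: add_closure_prod.
by rewrite opprD addrACA.
Qed.

Lemma g_vector_ses A U V (a : {linear A -> U}) (b : {linear U -> V}) v :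
  ses a b -> fgproj A -> g_vector V v -> g_vector U (mult_vec P A + v).
Proof.
move=> s fA [L [Q [i [p [sip fL fQ ->]]]]].
have [j [q sjq]] := ses_pullback s sip fQ.2.
exists L, (A * Q)%type, j, q; split=> //; first exact: fgproj_prod.
by rewrite mult_vecD ?addrA //; exact: fgproj_len.
Qed.

Lemma t_vector_ses A B C (i : {linear A -> B}) (p : {linear B -> C}) v :
  ses i p -> add_closure T C -> t_vector A v -> t_vector B (v + mult_vec T C).
Proof.
move=> s aC [U [V [a [b [sab aU aV ->]]]]].
have [j [q sjq]] := ses_pushout s sab (add_closure_ext1 aC aU).
exists (U * C)%type, V, j, q; split=> //; first exact: add_closure_prod.
by rewrite mult_vecD 1?addrAC //; exact: add_closure_fin_len.
Qed.

(** Evaluating [g_vector] along the coresolution of P j gives H G = 1, and evaluating [t_vector]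
    along the resolution of T i gives G H = 1. Each identity bounds one size by the other. *)
Lemma tilting_count : m = n.
Proof.
have /choice[g gE] i : exists v, g_vector (T i) v.
  have [L [Q [k [p [s fL fQ]]]]] := T_pd1 i.
  by exists (mult_vec P Q - mult_vec P L), L, Q, k, p.
have /choice[t tE] j : exists v, t_vector (P j) v.
  have [U [V [a [b [s aU aV]]]]] := P_cores j.
  by exists (mult_vec T U - mult_vec T V), U, V, a, b.
pose G : 'M[int]_(m, n) := \matrix_i g i; pose H : 'M[int]_(n, m) := \matrix_j t j.
have gG : forall X, add_closure T X -> g_vector X (mult_vec T X *m G).
  apply: additive_rel_mult => //.
  - exact: g_vector_iso.
  - move=> Z Z0; have := g_vector_proj (fgproj_zero Z0).
    by rewrite mult_vec_zero.
  - exact: g_vectorD.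
  - by move=> i; rewrite rowK.
have tH : forall X, add_closure P X -> t_vector X (mult_vec P X *m H).
  apply: additive_rel_mult => //.
  - exact: t_vector_iso.
  - move=> Z Z0; have := t_vector_add (add_closure_zero T Z0).
    by rewrite mult_vec_zero.
  - exact: t_vectorD.
  - by move=> i; rewrite rowK.
have HG : H *m G = 1%:M.
  apply/row_matrixP => j; rewrite row_mul rowK row1 -(mult_vec_gen j P_krull P_noniso).
  have [U [V [a [b [s aU aV E]]]]] := tE j.
  have := g_vector_unique (gG _ aU) (g_vector_ses s (P_fgproj j) (gG _ aV)).
  by move/eqP; rewrite -subr_eq -mulmxBl -E => /eqP.
have GH : G *m H = 1%:M.
  apply/row_matrixP => i; rewrite row_mul rowK row1 -(mult_vec_gen i T_krull T_noniso).
  have [L [Q [k [p [s fL fQ E]]]]] := gE i.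
  have := t_vector_unique (tH _ (P_add fQ))
    (t_vector_ses s (add_closure_gen T i) (tH _ (P_add fL))).
  by move/eqP; rewrite [in X in _ == X]addrC -subr_eq -mulmxBl -E => /eqP.
by apply/eqP; rewrite eqn_leq (mulmx1_min HG) (mulmx1_min GH).
Qed.

End Count.
End Additive.

(** * Partial tilting modules *)

Section Tilting.
Variable R : nzRingType.
Implicit Types (A B C E L P Q U V X Y Z M N T : lmodType R).

Lemma retract_summand X M (i : {linear X -> M}) (p : {linear M -> X}) :
  cancel i p -> exists Y, iso_mod (X * Y)%type M.
Proof.
move=> iK; have [Y [k [ki kE]]] := ker_ex p.
have [h hE] := sum_linear i k; exists Y; apply: (iso_bij (f := h)).
  move=> [x y] [x' y']; rewrite !hE /= => E.
  have pk c : p (k c) = 0 by apply/kE; exists c.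
  have := congr1 p E; rewrite !linearD !pk !addr0 !iK => xx; rewrite xx in E *.
  by rewrite (ki _ _ (addrI _ E)).
move=> m; have /kE[y yE] : p (m - i (p m)) = 0 by rewrite linearB /= iK subrr.
by exists (p m, y); rewrite hE /= yE addrC subrK.
Qed.

Lemma summand_retract X M : summand X M ->
  exists (i : {linear X -> M}) (p : {linear M -> X}), cancel i p.
Proof.
move=> [Y /iso_modP[f [g [fK gK]]]]; have [a aE] := inl_linear X Y.
by exists (f \o a), (fst \o g) => x; rewrite /= fK aE.
Qed.

Lemma summand_iso X M N : iso_mod M N -> summand X M -> summand X N.
Proof. by move=> I [Y J]; exists Y; exact: iso_trans J I. Qed.

Lemma pd1_summand X M : summand X M -> pd1 M -> pd1 X.
Proof. by move=> [Y I] /(pd1_iso (iso_sym I)); exact: pd1_prodl. Qed.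

Lemma fgproj_summand X M : summand X M -> fgproj M -> fgproj X.
Proof. by move=> [Y I] /(fgproj_iso (iso_sym I)); exact: fgproj_prodl. Qed.

Lemma fin_len_summand X M : summand X M -> fin_len M -> fin_len X.
Proof. by move=> /summand_retract[i [p iK]]; exact: fin_len_retract iK. Qed.

Lemma ext1_summand X Y M N : summand X M -> summand Y N -> ext1 M N -> ext1 X Y.
Proof.
move=> /summand_retract[i [p iK]] /summand_retract[j [q jK]] e.
exact: ext1_retractl iK (ext1_retractr jK e).
Qed.

Definition family (s : seq (lmodType R)) (i : 'I_(size s)) : lmodType R :=
  nth (zmodule R) s i.

Lemma add_closure_family s : add_closure (family (s := s)) (bsum s).
Proof.
exists s; split; first exact: iso_refl.
by move=> k ks; exists (Ordinal ks); exact: iso_refl.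
Qed.

Lemma summand_family s i : summand (family (s := s) i) (bsum s).
Proof. exact: bsum_nth. Qed.

Lemma bsum_direct_sum s : direct_sum (bsum s) (family (s := s)).
Proof.
(* Indexing by all natural numbers, with zero modules past the end of s, lets [nth] reduce along the
   induction without casts between ordinals. *)
suff [inj [prj [H1 H2 H3]]] : exists
    (inj : forall k, {linear nth (zmodule R) s k -> bsum s})
    (prj : forall k, {linear bsum s -> nth (zmodule R) s k}),
    [/\ forall k x, prj k (inj k x) = x,
        forall k l x, k != l -> prj l (inj k x) = 0
      & forall x, x = \sum_(k < size s) inj k (prj k x)].
  by exists (fun i => inj i), (fun i => prj i); split=> [i x|i j x ij|x]; [exact: H1|exact: H2|exact: H3].
elim: s => [|X s [inj [prj [H1 H2 H3]]]].
  exists (fun=> \0), (fun=> \0); split=> [k|k l x _|x] //.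
    by case: k => [|k] x; exact/esym/(zmodule0 R).
  by rewrite big_ord0; exact: zmodule0.
have [a aE] := inl_linear X (bsum s); have [b bE] := inr_linear X (bsum s).
exists (fun k => match k return {linear nth (zmodule R) (X :: s) k -> bsum (X :: s)} with
  | 0%N => a | k'.+1 => b \o inj k' end).
exists (fun k => match k return {linear bsum (X :: s) -> nth (zmodule R) (X :: s) k} with
  | 0%N => (fst : {linear (X * bsum s)%type -> X})
  | k'.+1 => prj k' \o (snd : {linear (X * bsum s)%type -> bsum s}) end).
split.
- by move=> [|k] x /=; rewrite ?aE ?bE /= ?H1.
- move=> [|k] [|l] x //=; rewrite ?aE ?bE /= ?linear0 //.
  by rewrite eqSS => kl; exact: H2.
- move=> [x y]; rewrite big_ord_recl /= aE.
  rewrite -[\sum_(i < size s) _]/(\sum_(i < size s) b (inj i (prj i y))).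
  by rewrite -linear_sum -H3 bE; congr pair; rewrite /= ?addr0 ?add0r.
Qed.

(** Discards isomorphic repetitions. The clause over all properties C records that the members of s'
    come from s. *)
Lemma representatives (s : seq (lmodType R)) : exists s',
  [/\ noniso (family (s := s')), forall C : lmodType R -> Prop, allp C s -> allp C s'
    & allp (fun Y => exists i, iso_mod Y (family (s := s') i)) s].
Proof.
elim: s => [|X s [s' [ns' ss' s's]]].
  by exists [::]; split=> // -[].
have [[i Xi]|nX] := pselect (exists i, iso_mod X (family (s := s') i)).
  exists s'; split=> //; first by move=> C /allp_cons[_ /ss'].
  by apply/allp_cons; split=> //; exists i.
exists (X :: s'); split.
- have K (i : 'I_(size s')) : ~ iso_mod X (nth (zmodule R) s' i) by move=> I; apply: nX; exists i.
  move=> [[|k] lk] [[|l] ll] /= I; apply/val_inj => //=.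
  + by case: (K (Ordinal (ll : (l < size s')%N))).
  + by case: (K (Ordinal (lk : (k < size s')%N))); exact: iso_sym.
  + by have /(congr1 val)/= -> := ns' (Ordinal (lk : (k < size s')%N)) (Ordinal (ll : (l < size s')%N)) I.
- by move=> C /allp_cons[CX /ss' Cs]; apply/allp_cons.
- apply/allp_cons; split.
    by exists ord0; exact: iso_refl.
  by apply: allp_impl s's => Y [i I]; exists (lift ord0 i).
Qed.

Lemma add_closure_representatives s s' :
  allp (fun Y => exists i, iso_mod Y (family (s := s') i)) s ->
  add_closure (family (s := s')) (bsum s).
Proof. by exists s; split=> //; exact: iso_refl. Qed.

Lemma num_summands_family M s : allp (@krull R) s -> noniso (family (s := s)) ->
  fin_len M -> add_closure (family (s := s)) M ->
  (forall i, summand (family (s := s) i) M) -> num_summands M (size s).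
Proof.
move=> ks ns lM aM sM; exists (family (s := s)); split=> //.
  by move=> i; split=> //; case: (ks i (ltn_ord i)).
move=> X iX [Y I]; apply: (krull_add_closure (A := Y)).
- by move=> i; exact: ks.
- by split=> //; apply: (fin_len_summand _ lM); exists Y.
- exact: add_closure_iso (iso_sym I) aM.
Qed.

Lemma num_summands_iso M N n : iso_mod M N -> num_summands M n -> num_summands N n.
Proof.
move=> I [F [F1 F2 F3]]; exists F; split=> // [i|X iX sX].
  by have [iF sF] := F1 i; split=> //; exact: summand_iso I sF.
by apply: F3 => //; exact: summand_iso (iso_sym I) sX.
Qed.

Lemma finitely_many_union n (C : 'I_n -> lmodType R -> Prop) (D : lmodType R -> Prop) :
  (forall k, finitely_many (C k)) -> (forall M, D M -> exists k, C k M) ->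
  finitely_many D.
Proof.
move=> H DC; pose m k := sval (cid (H k)).
pose F k := sval (cid (svalP (cid (H k)))).
have FP k : forall M, C k M -> exists i, iso_mod M (F k i) := svalP (cid (svalP (cid (H k)))).
exists #|{: {k : 'I_n & 'I_(m k)}}|,
  (fun t => F (tag (enum_val t)) (tagged (enum_val t))) => M /DC[k /FP[i MF]].
by exists (enum_rank (Tagged (fun k => 'I_(m k)) i)); rewrite enum_rankK.
Qed.

Lemma finitely_many_sub (C D : lmodType R -> Prop) :
  (forall M, D M -> C M) -> finitely_many C -> finitely_many D.
Proof. by move=> DC [n [F FP]]; exists n, F => M /DC/FP. Qed.

Lemma pd1_resolution M : pd1 M -> pdim_le M 1 /\ forall N, ext1 M N -> ext_eq0 1 M N.
Proof.
move=> [L [Q [i [p [[ii ps ip] fL fQ]]]]].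
pose P n := match n return lmodType R with 0%N => Q | 1%N => L | _ => zmodule R end.
pose d n := match n return {linear P n.+1 -> P n} with
  0%N => i | n'.+1 => (\0 : {linear P n'.+2 -> P n'.+1}) end.
have res : @proj_resolution R M P d p.
  split=> //.
  - by move=> [|[|n]] //; exact: fgproj_zero (zmodule0 R).
  - move=> [|n] y.
      split=> [/=|[x <-]]; last by rewrite /= linear0.
      by rewrite -(linear0 i) => /ii ->; exists 0.
    by split=> // _; exists 0; rewrite linear0; exact/esym/(zmodule0 R).
split.
  by exists P, d, p; split=> // -[|[|k]] // _; exact: zmodule0.
move=> N e; exists P, d, p; split=> // f _.
have [g gE] := e _ _ i p (And3 ii ps ip) f.
by exists g => x; rewrite gE.
Qed.

Lemma pdim_le_pd1 M : pdim_le M 1 -> pd1 M.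
Proof.
move=> [P [d [e [[fP es de dd] P0]]]]; exists (P 1%N), (P 0%N), (d 0%N), e.
have Z : zero_mod (P 2) by exact: P0.
split; [split=> //|exact: fP|exact: fP] => x y /eqP.
rewrite -subr_eq0 -linearB => /eqP/dd[z]; rewrite (Z z) linear0 => E.
by apply/eqP; rewrite -subr_eq0 E.
Qed.

(** The F k are arbitrary representatives of isomorphism classes; those without a number of summands
    contribute nothing, the others finitely many classes. *)
Lemma fin_many_summands n (F : 'I_n -> lmodType R) :
  finitely_many (fun M => indecomposable M /\
    exists k m, summand M (F k) /\ num_summands (F k) m).
Proof.
apply: (@finitely_many_union n (fun k M =>
  [/\ indecomposable M, summand M (F k) & exists m, num_summands (F k) m])).
  move=> k; have [[m [G [_ _ GP]]]|H] := pselect (exists m, num_summands (F k) m).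
    by exists m, G => M [iM sM _]; exact: GP.
  by exists 0%N, (fun=> zmodule R) => M [_ _ /H].
by move=> M [iM [k [m [sM kM]]]]; exists k; split=> //; exists m.
Qed.

Variables (K : fieldType) (z : {rmorphism K -> R}) (d : nat) (bas : 'I_d -> R).
Hypothesis b_span : spanning z bas.
Hypothesis z_central : forall k a, z k * a = a * z k.

(** Bongartz's construction is applied to M and each indecomposable projective P j. The sum T0 of M
    and all the extensions E j is rigid of projective dimension at most one; one copy of each of its
    indecomposable summands forms the basic module [bsum ts], and [tilting_count] gives its number
    of summands. *)
Lemma partial_tilting_summand M : indecomposable M -> pd1 M -> ext1 M M ->
  exists T, [/\ tilting T, basic_mod T & summand M T].
Proof.
move=> iM dM eM.
have fl X : fin_gen X -> fin_len X by exact: fin_gen_len b_span X.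
have fR : fgproj R^o.
  apply: (@dual_basis_fgproj R R^o 1 (fun=> 1) (fun=> idfun)) => y.
  by rewrite big_ord1 /= [_ *: _]mulr1.
have [s [ks sR]] := krull_decomposition (fl _ fR.1).
have [ps [nps sps sall]] := representatives s.
pose P := family (s := ps).
have kP j : krull (P j) by exact: sps ks _ _.
have aR : add_closure P R^o.
  exact: add_closure_iso (iso_sym sR) (add_closure_representatives sall).
have sP j : summand (P j) R^o.
  apply: summand_iso (iso_sym sR) _.
  have H : allp (fun X => summand X (bsum s)) s by move=> k; exact: bsum_nth.
  exact: (sps _ H j (ltn_ord j)).
have fP j : fgproj (P j) by exact: fgproj_summand (sP j) fR.
have aP Q : fgproj Q -> add_closure P Q.
  move=> fQ; have [[n [v /free_cover[p [qs _]]]] prQ] := fQ.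
  have [h hK] := prQ _ _ p (@idfun Q) qs.
  have [Y I] := retract_summand hK.
  apply: (add_closure_summand (Y := Y) kP); first exact: fl fQ.1.
  exact: add_closure_iso (iso_sym I) (add_closure_ffun _ aR).
have /choice[E /choice[r EP]] j := bongartz b_span z_central dM eM (fP j).
(* Index 0 stands for M, the others for the extensions E j. *)
pose F (o : 'I_(size ps).+1) := if unlift ord0 o is Some j then E j else M.
have dF o : pd1 (F o).
  by rewrite /F; case: unliftP => // j _; have [a [b []]] := EP j.
have eMF o : ext1 M (F o).
  by rewrite /F; case: unliftP => // j _; have [a [b []]] := EP j.
(* E j is an extension of a power of M by the projective P j, so Ext^1 out of E j vanishes wherever
   Ext^1 out of M does. *)
have eF o o' : ext1 (F o) (F o').
  have eo := eMF o'; rewrite {1}/F; case: unliftP => // j _.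
  have [a [b [sab _ _]]] := EP j.
  apply: (ext1_ses sab); first exact/ext1_projective/(fP j).2.
  exact: ext1_ffunl.
pose T0 := bsum [seq F o | o <- enum 'I_(size ps).+1].
have nthF o : nth (zmodule R) [seq F o | o <- enum 'I_(size ps).+1] (nat_of_ord o) = F o.
  by rewrite (nth_map ord0) ?size_enum_ord // nth_ord_enum.
have sF o : summand (F o) T0.
  by rewrite -(nthF o); apply: bsum_nth; rewrite size_map size_enum_ord.
have aT0 : add_closure F T0.
  exists [seq F o | o <- enum 'I_(size ps).+1]; split; first exact: iso_refl.
  move=> k; rewrite size_map size_enum_ord => lk; exists (Ordinal lk).
  by rewrite -(nthF (Ordinal lk)); exact: iso_refl.
have dT0 : pd1 T0.
  apply: add_closure_ind aT0 => //.
  - by move=> X Y; exact: pd1_iso.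
  - move=> Z Z0; exists Z, Z, \0, idfun; split; last exact: fgproj_zero.
      exact: ses_idr.
    exact: fgproj_zero.
  - exact: pd1_prod.
have eT0 : ext1 T0 T0 by exact: (add_closure_ext1 eF).
have lT0 : fin_len T0 := fl _ (pd1_fin_gen dT0).
have [t [kt tT0]] := krull_decomposition lT0.
have [ts [nts tts tall]] := representatives t.
pose T := family (s := ts).
have kts := tts _ kt.
have kT j : krull (T j) by exact: kts.
have aTT0 : add_closure T T0.
  exact: add_closure_iso (iso_sym tT0) (add_closure_representatives tall).
have sT j : summand (T j) T0.
  apply: summand_iso (iso_sym tT0) _.
  have H : allp (fun X => summand X (bsum t)) t by move=> k; exact: bsum_nth.
  exact: (tts _ H j (ltn_ord j)).
have aTF o : add_closure T (F o).
  have [Y I] := sF o.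
  apply: (add_closure_summand (Y := Y) kT); first exact: fl (pd1_fin_gen (dF o)).
  exact: add_closure_iso (iso_sym I) aTT0.
have aTM : add_closure T M by have := aTF ord0; rewrite /F unlift_none.
have dT j : pd1 (T j) by exact: pd1_summand (sT j) dT0.
have eT i j : ext1 (T i) (T j) by exact: ext1_summand (sT i) (sT j) eT0.
(* The Bongartz sequence of P j is the required coresolution. *)
have coT j : exists U V (a : {linear P j -> U}) (b : {linear U -> V}),
    [/\ ses a b, add_closure T U & add_closure T V].
  have [a [b [sab _ _]]] := EP j; exists (E j), {ffun 'I_(r j) -> M}, a, b.
  split=> //; last exact: add_closure_ffun.
  by have := aTF (lift ord0 j); rewrite /F liftK.
have count := tilting_count fl kP nps kT nts fP aP dT eT coT.
have dTs : pd1 (bsum ts).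
  apply: add_closure_ind (add_closure_family ts) => //.
  - by move=> X Y; exact: pd1_iso.
  - move=> Z Z0; exists Z, Z, \0, idfun; split; last exact: fgproj_zero.
      exact: ses_idr.
    exact: fgproj_zero.
  - exact: pd1_prod.
have eTs : ext1 (bsum ts) (bsum ts).
  exact: (add_closure_ext1 eT (add_closure_family ts) (add_closure_family ts)).
have [pTs xTs] := pd1_resolution dTs.
exists (bsum ts); split.
- split=> //; [exact: pd1_fin_gen|exact: xTs|exists (size ts); split].
    apply: num_summands_family => //; first exact: fl (pd1_fin_gen dTs).
      exact: add_closure_family.
    exact: summand_family.
  rewrite count; apply: num_summands_family => //; [exact: sps|exact: fl fR.1].
- exists (size ts), T; split=> //; first exact: bsum_direct_sum.
  by move=> i; case: (kT i).
- have kM : krull M by split=> //; exact: fl (pd1_fin_gen dM).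
  have [|i I] := krull_add_closure (A := zmodule R) kT kM.
    exact: add_closure_iso (iso_sym (iso_prodr0 _ (zmodule0 R))) aTM.
  have [Y J] := summand_family (s := ts) i.
  by exists Y; exact: iso_trans (iso_prod I (iso_refl _)) J.
Qed.

Lemma partial_tilting_finite : fin_many_basic_tilting R ->
  finitely_many (fun M => [/\ indecomposable M, pd1 M & ext1 M M]).
Proof.
move=> [n [F FP]]; apply: finitely_many_sub (fin_many_summands F).
move=> M [iM dM eM]; split=> //.
have [T [tT bT sM]] := partial_tilting_summand iM dM eM.
have [k I] := FP T (conj tT bT); have [_ _ _ [m [nT _]]] := tT.
exists k, m; split; [exact: summand_iso I sM|exact: num_summands_iso I nT].
Qed.

End Tilting.

(** * Duality of projective presentations *)

Lemma cokernel_map (R : nzRingType) (X0 X1 X Y0 Y1 Y : lmodType R)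
    (dx : {linear X1 -> X0}) (ex : {linear X0 -> X})
    (dy : {linear Y1 -> Y0}) (ey : {linear Y0 -> Y})
    (f0 : {linear X0 -> Y0}) (f1 : {linear X1 -> Y1}) :
  surj ex -> exact dx ex -> exact dy ey -> (forall x, f0 (dx x) = dy (f1 x)) ->
  exists m : {linear X -> Y}, forall x, m (ex x) = ey (f0 x).
Proof.
move=> exs xx yy fd.
have wd x : ex x = 0 -> ey (f0 x) = 0.
  by move=> /xx[y <-]; apply/yy; exists (f1 y); rewrite fd.
have [m mP] : exists m : {linear X -> Y}, forall x, exists y, ex y = x /\ m x = ey (f0 y).
  apply: (@linear_of_rel _ _ _ (fun x z => exists y, ex y = x /\ z = ey (f0 y))).
  - move=> a _ _ _ _ [y [<- ->]] [y' [<- ->]]; exists (a *: y + y').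
    by rewrite !linearP.
  - by move=> x; have [y yE] := exs x; exists (ey (f0 y)), y.
  - by move=> z [y [/wd e ->]].
exists m => x; have [y [e1 ->]] := mP (ex x).
by apply/eqP; rewrite -subr_eq0 -!linearB; apply/eqP/wd; rewrite linearB /= e1 subrr.
Qed.

Section Star.
Variable A : nzRingType.
Implicit Types (P Q M : lmodType A^c) (N : lmodType A).

Lemma star_of P (f : {linear P -> (A^c)^o}) :
  exists h : star P, forall x, h x = f x.
Proof.
have H : (f : P -> A) \in @star_pred A P by rewrite unfold_in; apply/asboolP; exact: linearP.
by exists (Star H).
Qed.

Lemma star_linear P (h : star P) :
  exists f : {linear P -> (A^c)^o}, forall x, f x = h x.
Proof.
by apply: linearize => a x y; case: h => h /=; rewrite unfold_in => /asboolP ->.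
Qed.

Lemma star_ev P (x : P) : exists f : {linear star P -> A^o}, forall h, f h = h x.
Proof. by apply: linearize. Qed.

Lemma star_ext P (g h : star P) : (forall x, g x = h x) -> g = h.
Proof. by move=> gh; apply/val_inj/funext. Qed.

Lemma star_map P Q (f : {linear P -> Q}) :
  exists s : {linear star Q -> star P}, forall g x, s g x = g (f x).
Proof.
have /choice[s sE] (g : star Q) : exists h : star P, forall x, h x = g (f x).
  have [g' g'E] := star_linear g; have [h hE] := star_of (g' \o f).
  by exists h => x; rewrite hE /= g'E.
have ls : linear s.
  move=> a g h; apply: star_ext => x; rewrite sE.
  by rewrite -[RHS]/(a * s g x + s h x) !sE.
by have [t tE] := linearize ls; exists t => g x; rewrite tE sE.
Qed.

Section DualBasis.
Variables (P : lmodType A^c) (n : nat) (p : 'I_n -> P).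
Variables (phi : 'I_n -> {linear P -> (A^c)^o}) (h : 'I_n -> star P).
Hypotheses (p_dual : dual_basis p phi) (hE : forall i x, h i x = phi i x).

Lemma star_dual_basis (g : star P) : g = \sum_(i < n) g (p i) *: h i.
Proof.
apply: star_ext => x; have [ev evE] := star_ev x; rewrite -[RHS]evE linear_sum.
have [g' g'E] := star_linear g; rewrite -[LHS]g'E [in LHS](p_dual x) linear_sum.
apply: eq_bigr => i _; rewrite !linearZ /= evE hE.
by rewrite g'E.
Qed.

Lemma star_separates x : (forall g : star P, g x = 0) -> x = 0.
Proof.
move=> g0; rewrite (p_dual x) big1 // => i _.
by rewrite -hE g0 scale0r.
Qed.

Lemma star_full Q (a : {linear star P -> star Q}) :
  exists b : {linear Q -> P}, forall g x, a g x = g (b x).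
Proof.
have /choice[f fE] i : exists f : {linear Q -> (A^c)^o}, forall x, f x = a (h i) x.
  exact: star_linear.
have [b bE] := linear_comb f p; exists b => g x.
have [g' g'E] := star_linear g; rewrite bE -[RHS]g'E linear_sum.
have [ev evE] := star_ev x.
rewrite [in LHS](star_dual_basis g) -evE !linear_sum; apply: eq_bigr => i _.
by rewrite !linearZ /= evE g'E fE.
Qed.

Lemma fgproj_star_aux : fgproj (star P).
Proof.
have /choice[ev evE] i := star_ev (p i).
apply: (@dual_basis_fgproj A (star P) n h ev) => g.
by rewrite [LHS]star_dual_basis; apply: eq_bigr => i _; rewrite evE.
Qed.
End DualBasis.

Lemma fgproj_star_basis P : fgproj P -> exists n (p : 'I_n -> P)
    (phi : 'I_n -> {linear P -> (A^c)^o}) (h : 'I_n -> star P),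
  dual_basis p phi /\ forall i x, h i x = phi i x.
Proof.
move=> /fgproj_dual_basis[n [p [phi pE]]].
have /choice[h hE] i := star_of (phi i).
by exists n, p, phi, h.
Qed.

Lemma fgproj_star P : fgproj P -> fgproj (star P).
Proof.
by move=> /fgproj_star_basis[n [p [phi [h [pE hE]]]]]; exact: fgproj_star_aux pE hE.
Qed.

Lemma star_sep P : fgproj P ->
  forall x y : P, (forall g : star P, g x = g y) -> x = y.
Proof.
move=> /fgproj_star_basis[n [p [phi [h [pE hE]]]]] x y gxy.
apply/eqP; rewrite -subr_eq0; apply/eqP/(star_separates pE hE) => g.
have [g' g'E] := star_linear g.
by rewrite -g'E linearB !g'E gxy subrr.
Qed.

(** Fullness of the duality on finitely generated projectives, with [star_sep] as faithfulness: maps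
    between duals are carried back without using the bidual. *)
Lemma star_lift P Q : fgproj P -> forall a : {linear star P -> star Q},
  exists b : {linear Q -> P}, forall g x, a g x = g (b x).
Proof.
by move=> /fgproj_star_basis[n [p [phi [h [pE hE]]]]] a; exact (star_full pE hE a).
Qed.

(* A presentation P1 -d-> P0 -e-> M -> 0 by finitely generated projectives     *)
(* whose A-dual 0 -> P0^* -t-> P1^* -c-> N -> 0 is exact.                      *)
Definition dual_resolution M N P1 P0 (d : {linear P1 -> P0}) (e : {linear P0 -> M})
    (t : {linear star P0 -> star P1}) (c : {linear star P1 -> N}) : Prop :=
  [/\ fgproj P1 /\ fgproj P0, surj e, exact d e, ses t c
    & forall g x, t g x = g (d x)].

(* Ext^1(-, A) on maps: nu is computed by the dual of b1.                      *)
Definition star_covers N N' P1 P1' (c : {linear star P1 -> N})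
    (c' : {linear star P1' -> N'}) (nu : N -> N') (b1 : P1' -> P1) : Prop :=
  forall (u : star P1) (w : star P1'), (forall x, w x = u (b1 x)) -> c' w = nu (c u).

(** * Comparison maps between dual resolutions *)

Section Lifts.
Variables (M : lmodType A^c) (N : lmodType A) (P1 P0 : lmodType A^c).
Variables (d : {linear P1 -> P0}) (e : {linear P0 -> M}).
Variables (t : {linear star P0 -> star P1}) (c : {linear star P1 -> N}).
Hypothesis D : dual_resolution d e t c.
Variables (M' : lmodType A^c) (N' : lmodType A) (P1' P0' : lmodType A^c).
Variables (d' : {linear P1' -> P0'}) (e' : {linear P0' -> M'}).
Variables (t' : {linear star P0' -> star P1'}) (c' : {linear star P1' -> N'}).
Hypothesis D' : dual_resolution d' e' t' c'.

(** The comparison theorem lifts nu to the projective resolutions of N and N'; fullness of the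
    duality turns the lifts into maps between the presentations of M' and M. *)
Lemma covers_lift (nu : {linear N -> N'}) :
  exists (b1 : {linear P1' -> P1}) (b0 : {linear P0' -> P0}),
    (forall x, b0 (d' x) = d (b1 x)) /\ star_covers c c' nu b1.
Proof.
case: D D' => [[f1 f0] es de s tE] [[f1' f0'] es' de' s' tE'].
have [ti cs tc] := s; have [ti' cs' tc'] := s'.
have [a1 a1E] := (fgproj_star f1).2 _ _ c' (nu \o c) cs'.
have [|a0 a0E] := @projective_lift A _ _ _ t' (a1 \o t) (fgproj_star f0).2.
  by move=> g; apply/tc'; rewrite /= a1E /= (ses_comp0 s) linear0.
have [b1 b1E] := star_lift f1 a1; have [b0 b0E] := star_lift f0 a0.
exists b1, b0; split=> [x|u w wE].
  apply: (star_sep f0) => g.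
  by rewrite -b0E -tE' a0E /= b1E tE.
have -> : w = a1 u by apply: star_ext => x; rewrite wE b1E.
exact: a1E.
Qed.

(** A chain map over zero is null-homotopic. The homotopy star P1 -> star P0' is dual to k, and b0 =
    d o k then induces zero from M' to M. *)
Lemma covers_zero (b1 : {linear P1' -> P1}) (b0 : {linear P0' -> P0}) :
  (forall x, b0 (d' x) = d (b1 x)) -> star_covers c c' (fun=> 0) b1 ->
  exists k : {linear P0' -> P1}, forall x, b0 x = d (k x).
Proof.
move=> bd bc; case: D D' => [[f1 f0] es de s tE] [[f1' f0'] es' de' s' tE'].
have [ti cs tc] := s; have [ti' cs' tc'] := s'.
have [a1 a1E] := star_map b1; have [a0 a0E] := star_map b0.
have [|h hE] := @projective_lift A _ _ _ t' a1 (fgproj_star f1).2.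
  by move=> u; apply/tc'; apply: (bc u) => x; rewrite a1E.
have [k kE] := star_lift f1 h; exists k => x; apply: (star_sep f0) => g.
have E : a0 g = h (t g).
  by apply: ti'; rewrite hE; apply: star_ext => y; rewrite tE' a0E bd a1E tE.
by rewrite -a0E E kE tE.
Qed.

End Lifts.

Lemma covers_comp N P1 (c : {linear star P1 -> N}) N' P1' (c' : {linear star P1' -> N'})
    N'' P1'' (c'' : {linear star P1'' -> N''}) (nu : N -> N') (nu' : N' -> N'')
    (b : {linear P1' -> P1}) (b' : {linear P1'' -> P1'}) :
  star_covers c c' nu b -> star_covers c' c'' nu' b' ->
  star_covers c c'' (nu' \o nu) (b \o b').
Proof.
move=> H H' u w wE; have [s sE] := star_map b.
by rewrite (H' (s u) w) ?(H u) // => x; rewrite ?sE ?wE.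
Qed.

Lemma covers_sub N P1 (c : {linear star P1 -> N}) N' P1' (c' : {linear star P1' -> N'})
    (nu nu' : N -> N') (b b' : {linear P1' -> P1}) :
  star_covers c c' nu b -> star_covers c c' nu' b' ->
  star_covers c c' (fun x => nu x - nu' x) (b \- b').
Proof.
move=> H H' u w wE; have [s sE] := star_map b; have [s' s'E] := star_map b'.
rewrite -(H u (s u)) // -(H' u (s' u)) // -linearB; congr (c' _).
apply: star_ext => x; rewrite wE -[RHS]/(s u x - s' u x) sE s'E /=.
by have [g gE] := star_linear u; rewrite -!gE linearB.
Qed.

Lemma covers_id N P1 (c : {linear star P1 -> N}) : star_covers c c id idfun.
Proof. by move=> u w wE; congr (c _); exact: star_ext. Qed.

Lemma covers_id_induces M N P1 P0 (d : {linear P1 -> P0}) (e : {linear P0 -> M})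
    (t : {linear star P0 -> star P1}) (c : {linear star P1 -> N})
    (b0 : {linear P0 -> P0}) (b1 : {linear P1 -> P1}) (nu : N -> N) :
  dual_resolution d e t c -> (forall x, b0 (d x) = d (b1 x)) ->
  star_covers c c nu b1 -> (forall y, nu y = y) -> forall x, e (b0 x) = e x.
Proof.
move=> D bd bc nuE x.
have [||k kE] := covers_zero D D (b1 := b1 \- idfun) (b0 := b0 \- idfun).
- by move=> y; rewrite /= bd linearB.
- by move=> u w wE; rewrite (covers_sub bc (@covers_id _ _ c) wE) nuE subrr.
have [_ _ de _ _] := D.
by apply/eqP; rewrite -subr_eq0 -linearB; apply/eqP/de; exists (k x); rewrite -kE.
Qed.

Definition transposed M N : Prop := exists P1 P0 (d : {linear P1 -> P0})
    (e : {linear P0 -> M}) (t : {linear star P0 -> star P1}) (c : {linear star P1 -> N}),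
  dual_resolution d e t c.

Lemma transposed_pd1 M N : transposed M N -> pd1 N.
Proof.
move=> [P1 [P0 [d [e [t [c [[f1 f0] _ _ s _]]]]]]].
by exists (star P0), (star P1), t, c; split=> //; exact: fgproj_star.
Qed.

(** M is Ext^1(N, A): it is the cokernel of the dual of the resolution of N. Mutually inverse maps
    of N and N' lift to chain maps whose composites are homotopic to identities, so they induce
    inverse maps on cokernels. *)
Lemma transposed_iso M N M' N' :
  transposed M N -> transposed M' N' -> iso_mod N N' -> iso_mod M M'.
Proof.
move=> [P1 [P0 [d [e [t [c D]]]]]] [P1' [P0' [d' [e' [t' [c' D']]]]]].
move=> /iso_modP[nu [nu' [nuK nu'K]]].
have [b1 [b0 [bd bc]]] := covers_lift D D' nu.
have [b1' [b0' [bd' bc']]] := covers_lift D' D nu'.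
have [_ es de _ _] := D; have [_ es' de' _ _] := D'.
have [m mE] := cokernel_map es de de' bd'.
have [m' m'E] := cokernel_map es' de' de bd.
apply/iso_modP; exists m, m'; split=> x.
  have [y <-] := es x; rewrite mE m'E.
  have H z : (b0 \o b0') (d z) = d ((b1 \o b1') z) by rewrite /= bd' bd.
  exact (covers_id_induces D H (covers_comp bc bc') nuK y).
have [y <-] := es' x; rewrite m'E mE.
have H z : (b0' \o b0) (d' z) = d' ((b1' \o b1) z) by rewrite /= bd bd'.
exact (covers_id_induces D' H (covers_comp bc' bc) nu'K y).
Qed.

End Star.

(** * Transposes of tau-rigid modules *)

Section Transpose.
Variable A : nzRingType.
Variables (M : lmodType A^c) (N : lmodType A) (P1 P0 : lmodType A^c).
Variables (d : {linear P1 -> P0}) (e : {linear P0 -> M}).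
Variables (t : {linear star P0 -> star P1}) (c : {linear star P1 -> N}).
Hypothesis D : dual_resolution d e t c.

(** If N were zero, the identity of P0 would factor through d, and e would vanish. *)
Lemma transpose_neq0 : ~ zero_mod M -> ~ zero_mod N.
Proof.
move=> M0 N0; apply: M0 => m; have [_ es de _ _] := D; have [x <-] := es m.
have H y : idfun (d y) = d (idfun y) by [].
have [|k kE] := covers_zero D D H; first by move=> u w wE; exact: N0.
by apply/de; exists (k x); rewrite -kE.
Qed.

(* If an idempotent nu of N induces zero on M, then nu factors through P1^*,   *)
(* so its image is a projective summand of N; minimality of d excludes that.   *)
Lemma covers_idem_zero (nu : {linear N -> N}) (b1 : {linear P1 -> P1})
    (b0 : {linear P0 -> P0}) :
  superfluous [pred x : P1 | d x == 0] ->
  (forall x, b0 (d x) = d (b1 x)) -> star_covers c c nu b1 ->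
  (forall n, nu (nu n) = nu n) -> (forall x, e (b0 x) = 0) ->
  forall n, nu n = 0.
Proof.
move=> sup bd bc nunu eb0; have [[f1 f0] es de s tE] := D.
have [ti cs tc] := s.
have [k kE] := @projective_lift _ P0 P1 P0 d b0 f0.2 (fun x => (de _).1 (eb0 x)).
have [a1 a1E] := star_map b1; have [h hE] := star_map k.
have a1t g : a1 (t g) = t (h (t g)).
  by apply: star_ext => x; rewrite a1E tE -bd -kE tE hE tE.
have ca1 u : c (a1 u) = nu (c u) by apply: bc => x; rewrite a1E.
(* The homotopy h corrects a1 so that it kills the image of t; rho is the induced map, and c o rho =
   nu. *)
have [rho rhoE] : exists rho : {linear N -> star P1},
    forall n, exists u, c u = n /\ rho n = a1 u - t (h u).
  apply: (@linear_of_rel A _ _ (fun n v => exists u, c u = n /\ v = a1 u - t (h u))).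
  - move=> b _ _ _ _ [u [<- ->]] [u' [<- ->]]; exists (b *: u + u').
    by rewrite !linearP scalerDr addrACA.
  - by move=> n; have [u uE] := cs n; exists (a1 u - t (h u)), u.
  - by move=> v [u [/tc[g <-] ->]]; rewrite a1t subrr.
have crho n : c (rho n) = nu n.
  have [u [<- ->]] := rhoE n.
  by rewrite linearB /= (ses_comp0 s) subr0 ca1.
have [kap kapE] := star_lift f1 (rho \o (nu \o c)).
have kapK x : kap (kap x) = kap x.
  by apply: (star_sep f1) => g; rewrite -!kapE /= crho !nunu.
have dkap x : d (kap x) = 0.
  apply: (star_sep f0) => g; rewrite -tE -kapE /= (ses_comp0 s) !linear0.
  by have [g' g'E] := star_linear g; rewrite -g'E linear0.
have kap0 x : kap x = 0.
  have S : submod_closed [pred x | kap x == 0].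
    split=> [|b y y']; rewrite !inE ?linear0 // => /eqP y0 /eqP y'0.
    by rewrite linearP y0 y'0 scaler0 addr0.
  have := sup _ S _ x; rewrite !inE => H; apply/eqP/H => y.
  exists (y - kap y), (kap y); rewrite !inE linearB /= kapK subrr dkap.
  by rewrite subrK.
move=> n; have [u <-] := cs n.
rewrite -nunu -nunu -crho; suff -> : rho (nu (nu (c u))) = 0 by rewrite linear0.
rewrite nunu; apply: star_ext => x.
have -> : rho (nu (c u)) x = u (kap x) by rewrite -kapE.
by rewrite kap0; have [g gE] := star_linear u; rewrite -gE linear0.
Qed.

(** The projection of N onto X is an idempotent nu, and it induces an idempotent mu of M, which is 0
    or 1. Accordingly nu or 1 - nu induces zero on M, and [covers_idem_zero] makes it vanish. *)
Lemma transpose_indecomposable :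
  superfluous [pred x : P1 | d x == 0] -> indecomposable M -> indecomposable N.
Proof.
move=> sup iM; split=> [|X Y /iso_modP[f [g [fK gK]]]].
  exact: transpose_neq0 iM.1.
have [i iE] := inl_linear X Y; pose nu : {linear N -> N} := g \o (i \o (fst \o f)).
have nuE n : nu n = g ((f n).1, 0) by rewrite /= iE.
have nunu n : nu (nu n) = nu n by rewrite !nuE gK.
have [b1 [b0 [bd bc]]] := covers_lift D D nu.
have [_ es de _ _] := D.
have [mu muE] := cokernel_map es de de bd.
have mumu m : mu (mu m) = mu m.
  have [x <-] := es m; rewrite !muE.
  have H z : ((b0 \o b0) \- b0) (d z) = d (((b1 \o b1) \- b1) z).
    by rewrite /= !bd linearB.
  have [|k kE] := covers_zero D D (b1 := (b1 \o b1) \- b1) H.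
    move=> u w wE; rewrite (covers_sub (covers_comp bc bc) bc wE) /= -!/(nu _).
    by rewrite -[g (i _)]/(nu (nu (c u))) -[g (i (f _).1)]/(nu (c u)) nunu subrr.
  by apply/eqP; rewrite -subr_eq0 -linearB; apply/eqP/de; exists (k x); rewrite -kE.
have [mu0|mu1] := indec_idem iM mumu.
  have nu0 : forall n, nu n = 0.
    by apply: (covers_idem_zero sup bd bc nunu) => x; rewrite -muE mu0.
  left=> x; have := nu0 (g (x, 0)); rewrite nuE gK /= => /(congr1 f).
  by rewrite gK linear0 => -[].
have nu1 : forall n, (idfun \- nu) n = 0.
  apply: (covers_idem_zero (b1 := idfun \- b1) (b0 := idfun \- b0) sup) => [x|||x].
  - by rewrite /= bd linearB.
  - exact: covers_sub (covers_id c) bc.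
  - move=> n; rewrite -[LHS]/((n - nu n) - nu (n - nu n)) linearB nunu subrr.
    by rewrite subr0.
  - by rewrite /= linearB /= -muE mu1 subrr.
right=> y; have /eqP := nu1 (g (0, y)).
rewrite -[(_ \- _) _]/(g (0, y) - nu (g (0, y))) nuE gK /= subr_eq0 => /eqP/(congr1 f).
by rewrite !gK => -[].
Qed.

End Transpose.

(** * Tau-rigidity as a lifting property *)

Section TauRigid.
Variables (K : fieldType) (A : falgType K).
Implicit Types (M : lmodType A^c) (N : lmodType A).

Lemma falg_spanning : exists n (b : 'I_n -> A), forall a : A,
  exists k : 'I_n -> K, a = \sum_(i < n) (k i)%:A * b i.
Proof.
exists (\dim {: A}), (fun i => (vbasis {: A})`_i) => a.
exists (fun i => coord (vbasis {: A}) i a).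
rewrite {1}(coord_vbasis (memvf a)); apply: eq_bigr => i _.
by rewrite -scalerAl mul1r.
Qed.

Lemma scalar_central (k : K) (a : A) : k%:A * a = a * k%:A.
Proof. by rewrite -scalerAl -scalerAr mul1r mulr1. Qed.

Lemma scalar_rmorphism :
  exists z : {rmorphism K -> A}, forall k, z k = k%:A.
Proof. by exists (in_alg A). Qed.

Lemma scalar_rmorphism_conv :
  exists z : {rmorphism K -> A^c}, forall k, z k = k%:A :> A.
Proof.
pose f (k : K) : A^c := k%:A : A.
have fD : {morph f : x y / x - y} by move=> x y; exact: (scalerBl x y (1 : A)).
have fM : monoid_morphism f.
  split=> [|x y]; first exact: (scale1r (1 : A)).
  rewrite -[RHS]/((y%:A : A) * (x%:A : A)) -scalerAl mul1r scalerA.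
  by rewrite mulrC.
pose f1 := HB.pack f (GRing.isZmodMorphism.Build K A^c f fD) (GRing.isMonoidMorphism.Build K A^c f fM)
  : {rmorphism K -> A^c}.
by exists f1.
Qed.

Lemma dual_of N (f : N -> K) :
  (forall k x y, f (k%:A *: x + y) = k * f x + f y) ->
  exists g : dual N, forall x, g x = f x.
Proof.
move=> fl; have H : f \in @dual_pred K A N by rewrite unfold_in; apply/asboolP.
by exists (Dual H).
Qed.

Lemma dual_ext N (f g : dual N) : (forall x, f x = g x) -> f = g.
Proof. by move=> fg; apply/val_inj/funext. Qed.

Lemma dual_linear M N (F : M -> dual N) :
  (forall (a : A^c) m m' n, F (a *: m + m') n = F m ((a : A) *: n) + F m' n) ->
  exists G : {linear M -> dual N}, forall m, G m = F m.
Proof.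
by move=> H; apply: linearize => a m m'; apply: dual_ext => n; exact: H.
Qed.

Section Separation.
Variables (M : lmodType A^c) (N : lmodType A) (P1 P0 : lmodType A^c).
Variables (d : {linear P1 -> P0}) (e : {linear P0 -> M}) (c : {linear star P1 -> N}).
Hypotheses (f1 : fgproj P1) (f0 : fgproj P0) (es : surj e) (de : exact d e).
Hypothesis cs : surj c.
Hypothesis cker : forall u : star P1,
  c u = 0 <-> exists g : star P0, forall x, u x = g (d x).
Hypothesis hom0 : forall f : {linear M -> dual N}, forall x, f x = 0.

(* A functional that vanishes on the maps factoring through d is an element of *)
(* Hom(M, dual N), via M -> dual N, m |-> (c u |-> theta (m . u)).             *)
Lemma hom_dual_extension (phi : {linear P1 -> M}) :
  exists psi : {linear P0 -> M}, forall x, phi x = psi (d x).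
Proof.
have [n [q [ph [h [qE hE]]]]] := fgproj_star_basis f1.
have [z zE] := scalar_rmorphism_conv.
have [m [b b_span]] := falg_spanning.
have zb : @spanning K A^c z m b.
  move=> a; have [k ->] := b_span a; exists k; apply: eq_bigr => i _.
  by rewrite -[RHS]/(b i * (z (k i) : A)) zE scalar_central.
have lM : @fin_len K {ffun 'I_n -> res z M}.
  exact: fin_len_ffun (fin_len_res zb (fin_gen_surj es f0.1)).
(* Maps P1 -> M are recorded by their values on the dual basis q; W consists of those that factor
   through d. *)
pose W (w : {ffun 'I_n -> res z M}) :=
  exists psi : {linear P0 -> M}, forall i, w i = psi (d (q i)).
have zC k (a : A^c) : z k * a = a * z k.
  by rewrite -[LHS]/(@GRing.mul A a (z k)) -[RHS]/(@GRing.mul A (z k) a) zE scalar_central.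
have sW : submod W.
  split=> [|k x y [f fE] [g gE]]; first by exists \0 => i; rewrite ffunE.
  have [l lE] : exists l : {linear P0 -> M}, forall x, l x = z k *: f x + g x.
    apply: linearize => a u u'.
    by rewrite !linearP !scalerDr !scalerA zC addrACA.
  by exists l => i; rewrite !ffunE lE -fE -gE.
pose v : {ffun 'I_n -> res z M} := [ffun i => phi (q i)].
have [[psi psiE]|Wv] := pselect (W v).
  exists psi => x; rewrite [in LHS](qE x) [in RHS](qE x) !linear_sum.
  by apply: eq_bigr => i _; have := psiE i; rewrite ffunE !linearZ /= => ->.
exfalso; have [theta [thW thv]] := separation lM sW Wv.
(* The map y |-> x . u(y), which plays the role of the tensor of x and u. *)
pose vec (u : star P1) (x : M) : {ffun 'I_n -> res z M} := [ffun i => (u (q i) : A^c) *: x].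
have vecD u u' x : vec (u + u') x = vec u x + vec u' x.
  by apply/ffunP => i; rewrite !ffunE -[LHS]/((u (q i) + u' (q i) : A^c) *: x) scalerDl.
have vecZ (a : A) u x : vec (a *: u) x = vec u ((a : A^c) *: x).
  by apply/ffunP => i; rewrite !ffunE scalerA.
have vecP u (a : A^c) x x' : vec u (a *: x + x') = vec ((a : A) *: u) x + vec u x'.
  by rewrite vecZ; apply/ffunP => i; rewrite !ffunE scalerDr.
have vec0 u x : c u = 0 -> theta (vec u x) = 0.
  move=> /cker[g gE]; apply: thW.
  have [g' g'E] := star_linear g.
  have [l lE] : exists l : {linear P0 -> M}, forall y, l y = (g' y : A^c) *: x.
    by apply: linearize => a y y'; rewrite linearP scalerDl scalerA.
  by exists l => i; rewrite ffunE lE g'E gE.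
have wd u u' x : c u = c u' -> theta (vec u x) = theta (vec u' x).
  move=> /eqP; rewrite -subr_eq0 -linearB => /eqP/vec0 H.
  by rewrite -[u](subrK u') vecD linearD H add0r.
have [s sE] := choice cs.
(* By [wd] the value theta (vec u x) depends on u only through c u, so it defines a functional on N
   for each x. *)
have /choice[F FE] x : exists f : dual N, forall y, f y = theta (vec (s y) x).
  apply: dual_of => k y y'.
  rewrite (wd _ (k%:A *: s y + s y')); last by rewrite sE linearP !sE.
  rewrite vecD linearD -[k * _]linearZ; congr (theta _ + _).
  by rewrite vecZ; apply/ffunP => i; rewrite !ffunE res_scaleE zE !scalerA -zE zC.
have [G GE] : exists G : {linear M -> dual N}, forall x, G x = F x.
  apply: dual_linear => a x x' y; rewrite !FE vecP linearD; congr (_ + _).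
  by apply: wd; rewrite linearZ /= !sE.
apply: thv.
(* The dual basis writes phi as a sum of elementary maps, on each of which theta vanishes because G
   = 0. *)
have -> : v = \sum_j vec (h j) (phi (q j)).
  apply/ffunP => i; rewrite ffunE sum_ffunE [in LHS](qE (q i)) linear_sum.
  by apply: eq_bigr => j _; rewrite linearZ ffunE hE.
rewrite linear_sum big1 // => j _.
rewrite -(wd (s (c (h j)))) ?sE //.
by rewrite -FE -GE hom0.
Qed.

(** The argument of [hom_dual_extension] with the factors exchanged: a functional on Hom(star P0, N)
    that kills the maps factoring through t gives a map P0 -> D N that is zero on the image of d,
    hence a map M -> D N. *)
Lemma transpose_hom_extension (t : {linear star P0 -> star P1})
    (phi : {linear star P0 -> N}) :
  (forall g x, t g x = g (d x)) ->
  exists psi : {linear star P1 -> N}, forall g, phi g = psi (t g).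
Proof.
move=> tE; have [n [p [ph [h [pE hE]]]]] := fgproj_star_basis f0.
have [z zE] := scalar_rmorphism.
have [m [b b_span]] := falg_spanning.
have zb : @spanning K A z m b.
  by move=> a; have [k ->] := b_span a; exists k; apply: eq_bigr => i _; rewrite zE.
have lN : @fin_len K {ffun 'I_n -> res z N}.
  exact: fin_len_ffun (fin_len_res zb (fin_gen_surj cs (fgproj_star f1).1)).
pose W (w : {ffun 'I_n -> res z N}) :=
  exists psi : {linear star P1 -> N}, forall i, w i = psi (t (h i)).
have zC k (a : A) : z k * a = a * z k by rewrite zE scalar_central.
have sW : submod W.
  split=> [|k x y [f fE] [g gE]]; first by exists \0 => i; rewrite ffunE.
  have [l lE] : exists l : {linear star P1 -> N}, forall x, l x = z k *: f x + g x.
    apply: linearize => a u u'.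
    by rewrite !linearP !scalerDr !scalerA zC addrACA.
  by exists l => i; rewrite !ffunE lE -fE -gE.
pose v : {ffun 'I_n -> res z N} := [ffun i => phi (h i)].
have [[psi psiE]|Wv] := pselect (W v).
  exists psi => g; rewrite [g in LHS](star_dual_basis pE hE).
  rewrite [g in RHS](star_dual_basis pE hE) !linear_sum.
  by apply: eq_bigr => i _; have := psiE i; rewrite ffunE !linearZ /= => ->.
exfalso; have [theta [thW thv]] := separation lN sW Wv.
pose vec (x : P0) (y : N) : {ffun 'I_n -> res z N} := [ffun i => h i x *: y].
have vecD x y y' : vec x (y + y') = vec x y + vec x y'.
  by apply/ffunP => i; rewrite !ffunE scalerDr.
have vecP (a : A^c) x x' y : vec (a *: x + x') y = vec x ((a : A) *: y) + vec x' y.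
  apply/ffunP => i; rewrite !ffunE; have [g gE] := star_linear (h i).
  by rewrite -!gE linearP scalerA; exact: (scalerDl y (@GRing.mul A (g x) a) (g x')).
have /choice[F FE] x : exists f : dual N, forall y, f y = theta (vec x y).
  apply: dual_of => k y y'.
  rewrite vecD linearD -[k * _]linearZ; congr (theta _ + _).
  by apply/ffunP => i; rewrite !ffunE res_scaleE zE !scalerA scalar_central.
have [F' F'E] : exists G : {linear P0 -> dual N}, forall x, G x = F x.
  by apply: dual_linear => a x x' y; rewrite !FE vecP linearD.
have Fd x : F' (d x) = 0.
  apply: dual_ext => y; rewrite F'E FE; apply: thW.
  have [ev evE] := star_ev x.
  have [l lE] : exists l : {linear star P1 -> N}, forall u, l u = (ev u : A) *: y.
    by apply: linearize => a u u'; rewrite linearP scalerDl scalerA.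
  by exists l => i; rewrite ffunE lE evE tE.
have [G GE] : exists G : {linear M -> dual N}, forall x, G (e x) = idfun (F' x).
  have H x : F' (d x) = (\0 : {linear zmodule A^c -> dual N}) ((\0 : {linear P1 -> zmodule A^c}) x).
    by rewrite Fd.
  apply: (cokernel_map es de _ H) => y; split=> [/= ->|[x <-] //].
  by exists 0.
apply: thv.
have -> : v = \sum_j vec (p j) (phi (h j)).
  apply/ffunP => i; rewrite ffunE sum_ffunE [h i in LHS](star_dual_basis pE hE) linear_sum.
  by apply: eq_bigr => j _; rewrite linearZ ffunE.
rewrite linear_sum big1 // => j _.
by rewrite -FE -F'E -[F' _]/(idfun (F' _)) -GE hom0.
Qed.

Lemma tau_rigid_ext1 : ext1 M M.
Proof.
apply: (ext1_presentation f0.2 de es) => f _.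
exact: hom_dual_extension.
Qed.

Hypothesis M_dual0 : forall f : {linear M -> (A^c)^o}, forall x, f x = 0.

(** An element of star P0 that vanishes on the image of d factors through e, hence through a map M
    -> A, which is zero; so t is injective. *)
Lemma transpose_dual_resolution : exists t : {linear star P0 -> star P1},
  dual_resolution d e t c.
Proof.
have [t tE] := star_map d; exists t; split=> //; split=> //.
  move=> g g' /eqP; rewrite -subr_eq0 -linearB => /eqP t0; apply/eqP.
  rewrite -subr_eq0; apply/eqP; apply: star_ext => x.
  set k := g - g' in t0 *; have [l lE] := star_linear k.
  have H y : l (d y) = (\0 : {linear zmodule A^c -> (A^c)^o}) ((\0 : {linear P1 -> zmodule A^c}) y).
    by rewrite lE -tE t0.
  have [|f fE] := cokernel_map (ey := idfun) es de _ H.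
    by move=> y; split=> [/= ->|[y' <-] //]; exists 0.
  by rewrite -lE -[l x]/(idfun (l x)) -fE M_dual0.
move=> u; rewrite cker; split=> -[g gE]; exists g.
  by apply: star_ext => x; rewrite tE gE.
by move=> x; rewrite -gE tE.
Qed.

Lemma transpose_ext1 : ext1 N N.
Proof.
have [t [_ _ _ [ti _ tc] tE]] := transpose_dual_resolution.
apply: (ext1_presentation (fgproj_star f1).2 tc cs) => f _.
by have [psi psiE] := transpose_hom_extension f tE; exists psi.
Qed.

End Separation.
End TauRigid.

(** * The two cases of the theorem *)

Lemma ext0_hom0 (R : nzRingType) (M X : lmodType R) : ext_eq0 0 M X ->
  forall f : {linear M -> X}, forall x, f x = 0.
Proof.
move=> [P [d [e [[_ es de _] H]]]] f x; have [y <-] := es x.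
apply: (H (f \o e)) => u /=; have -> : e (d 0%N u) = 0 by apply/de; exists u.
exact: linear0.
Qed.

Theorem theorem1p4 (K : closedFieldType) (Lambda : falgType K)
    (hbasic : basic_alg Lambda)
    (hconn : connected_alg Lambda)
    (hgldim : gldim_eq Lambda^c 2)
    (htilt : fin_many_basic_tilting Lambda^c)
    (htilt_op : fin_many_basic_tilting Lambda)
    (hgrade : forall M : lmodType Lambda^c,
       fin_gen M -> indecomposable M -> tau_rigid M -> pdim_eq M 2 ->
       grade2 M) :
  tau_tilting_finite Lambda.
Proof.
have [n [b b_span]] := @falg_spanning K Lambda.
have fin_right : finitely_many (fun M : lmodType Lambda^c =>
    [/\ indecomposable M, pd1 M & ext1 M M]).
  have [z zE] := @scalar_rmorphism_conv K Lambda.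
  have zC k (a : Lambda^c) : z k * a = a * z k.
    by rewrite -[LHS]/(@GRing.mul Lambda a (z k)) -[RHS]/(@GRing.mul Lambda (z k) a) zE scalar_central.
  apply: (@partial_tilting_finite Lambda^c K z n b _ zC htilt) => a.
  have [k ->] := b_span a; exists k; apply: eq_bigr => i _.
  by rewrite -[RHS]/(b i * (z (k i) : Lambda)) zE scalar_central.
have fin_left : finitely_many (fun N : lmodType Lambda =>
    [/\ indecomposable N, pd1 N & ext1 N N]).
  have [z zE] := @scalar_rmorphism K Lambda.
  have zC k (a : Lambda) : z k * a = a * z k by rewrite zE scalar_central.
  apply: (@partial_tilting_finite Lambda K z n b _ zC htilt_op) => a.
  by have [k ->] := b_span a; exists k; apply: eq_bigr => i _; rewrite zE.
have fin_transposed : finitely_many (fun M : lmodType Lambda^c =>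
    exists N : lmodType Lambda, transposed M N /\ [/\ indecomposable N, pd1 N & ext1 N N]).
  have [m [F FP]] := fin_left.
  (* For each class F i of left modules pick one M with transpose isomorphic to F i, or the zero
     module if there is none; [transposed_iso] makes any other choice isomorphic to it. *)
  have /choice[G GP] i : exists M : lmodType Lambda^c,
      forall M' N', transposed M' N' -> iso_mod N' (F i) -> iso_mod M' M.
    have [[M [N [MN NF]]]|H] := pselect (exists M N, transposed M N /\ iso_mod N (F i)).
      exists M => M' N' MN' N'F; apply: (transposed_iso MN' MN).
      exact: iso_trans N'F (iso_sym NF).
    by exists (zmodule _) => M' N' MN' N'F; case: H; exists M', N'.
  by exists m, G => M [N [MN /FP[i NF]]]; exists i; exact: GP MN NF.
(* Index 0 collects the modules of projective dimension at most one, index 1 those reached through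
   their transpose. *)
apply: (@finitely_many_union _ 2 (fun k => if k == 0 then _ else _)) => [k|M [fM iM tM]].
  by case: (k == 0); [exact: fin_right|exact: fin_transposed].
have [N [[P1 [P0 [d [e [c [[[g1 p1 g0 p0] es de _ sup] cs cker]]]]]] hom0]] := tM.
have [dM|ndM] := pselect (pd1 M).
  exists 0; rewrite eqxx; split=> //.
  exact: (tau_rigid_ext1 (conj g1 p1) (conj g0 p0) es de cs cker hom0).
exists 1; rewrite /=; exists N.
(* The global dimension gives the upper bound; a resolution of length k < 2 is also one of length 1,
   contrary to the case at hand. *)
have pdM : pdim_eq M 2.
  split=> [|k Mk]; first exact: hgldim.1.
  rewrite leqNgt; apply/negP => k2; apply: ndM; apply: pdim_le_pd1.
  move: Mk => [P [d' [e' [res P0']]]]; exists P, d', e'; split=> // i i1.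
  by apply: P0'; apply: leq_trans i1; rewrite ltnS; rewrite ltnS in k2.
(* Degree 0 of the grade condition is Hom(M, Lambda) = 0. *)
have M0 := ext0_hom0 ((hgrade _ fM iM tM pdM).1 0%N isT).
have [t D] := transpose_dual_resolution (conj g1 p1) (conj g0 p0) es de cs cker M0.
have MN : transposed M N by exists P1, P0, d, e, t, c.
split=> //; split; last 1 first.
- exact: (transpose_ext1 (conj g1 p1) (conj g0 p0) es de cs cker hom0 M0).
- exact: transpose_indecomposable D sup iM.
- exact: transposed_pd1 MN.
Qed.
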